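(* Let $W$ be a finite Coxeter group with a weight function $L$ with $L(s)>0$ for all $s\in S$, satisfying properties P1–P15. Let $\mathbf c$ be a two-sided cell of $W$; let $a$ be the (constant) value of the function $\mathbf a$ on $\mathbf c$ and let $a'$ be the (constant) value of $\mathbf a$ on the two-sided cell $w_0\mathbf c=\mathbf c w_0$. There exists a unique permutation $u\mapsto u^*$ of $\mathbf c$ (with square $1$) such that for any $u\in\mathbf c$ we have $$v^{a-a'}T_{w_0}c_u^\dagger=\epsilon_u c_{u^*}^\dagger \mod \mathcal H^{<\mathbf c}$$ where $\epsilon_u=\pm1$. Moreover, for any $u\in\mathbf c$ we have $\epsilon_{u^{-1}}=\epsilon_u=\epsilon_{\sigma(u)}=\epsilon_{u^*}$ and $\sigma(u^* )=(\sigma(u))^*=((u^{-1})^* )^{-1}$.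
   Context: $W$ is a finite Coxeter group with simple reflections $S$, length function $l:W\to\mathbb N$ and longest element $w_0$. A weight function is $L:W\to\mathbb N$ with $L(ww')=L(w)+L(w')$ whenever $l(ww')=l(w)+l(w')$; assume $L(s)>0$ for $s\in S$. Let $\sigma:W\to W$, $\sigma(w)=w_0ww_0$. Hecke algebra: $\mathcal A=\mathbb Z[v,v^{-1}]$ ($v$ an indeterminate). $\mathcal H$ is the $\mathcal A$-algebra with basis $\{T_x;x\in W\}$, $T_xT_y=T_{xy}$ if $l(xy)=l(x)+l(y)$, $(T_s-v^{L(s)})(T_s+v^{-L(s)})=0$ for $s\in S$. The bar involution is the ring involution of $\mathcal H$ with $v\mapsto v^{-1}$, $T_x\mapsto T_{x^{-1}}^{-1}$. $\{c_x;x\in W\}$ is the unique $\mathcal A$-basis with $\overline{c_x}=c_x$, $c_x=\sum_y p_{y,x}T_y$, $p_{x,x}=1$, $p_{y,x}\in v^{-1}\mathbb Z[v^{-1}]$ for $y\neq x$. $h\mapsto h^\dagger$ is the $\mathcal A$-algebra automorphism $T_x\mapsto(-1)^{l(x)}T_{x^{-1}}^{-1}$. Define $h_{x,y,z}\in\mathcal A$ by $c_xc_y=\sum_z h_{x,y,z}c_z$. Cells: $\le_{\mathcal L}$ is the preorder on $W$ generated by: $w\le_{\mathcal L}w'$ if $c_w$ appears with nonzero coefficient in $c_sc_{w'}$ for some $s\in S$; $w\le_{\mathcal R}w'$ iff $w^{-1}\le_{\mathcal L}w'^{-1}$; $\le_{\mathcal{LR}}$ is the preorder generated by $\le_{\mathcal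 L},\le_{\mathcal R}$. The associated equivalence relations are $\sim_{\mathcal L},\sim_{\mathcal R},\sim_{\mathcal{LR}}$, with classes the left, right, two-sided cells; $x<_{\mathcal{LR}}y$ means $x\le_{\mathcal{LR}}y$ and $x\not\sim_{\mathcal{LR}}y$. For a two-sided cell $\mathbf c$, $w_0\mathbf c=\mathbf cw_0$ is again a two-sided cell. $\mathcal H^{<\mathbf c}$ is the $\mathcal A$-span of the $c_x^\dagger$ with $x<_{\mathcal{LR}}x'$ for some $x'\in\mathbf c$ (a two-sided ideal). For $z\in W$, $\mathbf a(z)\in\mathbb N$ is the smallest integer with $h_{x,y,z}\in v^{\mathbf a(z)}\mathbb Z[v^{-1}]$ for all $x,y$; $\gamma_{x,y,z^{-1}}\in\mathbb Z$ is the coefficient of $v^{\mathbf a(z)}$ in $h_{x,y,z}$. Write $p_{1,z}=n_zv^{-\Delta(z)}+$ strictly smaller powers of $v$, $n_z\in\mathbb Z-\{0\}$; $\mathcal D=\{z\in W;\mathbf a(z)=\Delta(z)\}$. Properties P1–P15 (assumed to hold for $W,L$): P1: $\mathbf a(z)\le\Delta(z)$ for all $z$. P2: if $d\in\mathcal D$, $\gamma_{x,y,d}\ne0$ then $x=y^{-1}$. P3: for $y\in W$ there is a unique $d\in\mathcal D$ with $\gamma_{y^{-1},y,d}\ne0$. P4: $z'\le_{\mathcal{LR}}z$ implies $\mathbf a(z')\ge\mathbf a(z)$ (so $\mathbf a$ is constant on two-sided cells). P5: if $d\in\mathcal D$ and $\gamma_{y^{-1},y,d}\neq0$ then $\gamma_{y^{-1},y,d}=n_d=\pm1$.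 P6: $d^2=1$ for $d\in\mathcal D$. P7: $\gamma_{x,y,z}=\gamma_{y,z,x}$. P8: $\gamma_{x,y,z}\ne0$ implies $x\sim_{\mathcal L}y^{-1}$, $y\sim_{\mathcal L}z^{-1}$, $z\sim_{\mathcal L}x^{-1}$. P9, P10, P11: for $*=\mathcal L,\mathcal R,\mathcal{LR}$ respectively, $z'\le_*z$ and $\mathbf a(z')=\mathbf a(z)$ imply $z'\sim_*z$. P12: for $I\subset S$ and $y\in W_I$, $\mathbf a(y)$ computed in $W_I$ equals $\mathbf a(y)$ computed in $W$. P13: any left cell $\Gamma$ contains a unique $d\in\mathcal D$, and $\gamma_{x^{-1},x,d}\ne0$ for all $x\in\Gamma$. P14: $z\sim_{\mathcal{LR}}z^{-1}$. P15: with $h'_{x,y,z}$ obtained from $h_{x,y,z}$ by replacing $v$ by a second indeterminate $v'$, if $\mathbf a(w)=\mathbf a(y)$ then $\sum_{y'}h'_{w,x',y'}h_{x,y',y}=\sum_{y'}h_{x,w,y'}h'_{y',x',y}$ for all $x,x'$. *)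

(* Defs.v *)
From HB Require Import structures.
From mathcomp Require Import all_boot all_order all_algebra all_fingroup.
From mathcomp Require Import finmap.
From mathcomp.multinomials Require Import monalg.

Set Implicit Arguments.
Unset Strict Implicit.
Unset Printing Implicit Defensive.

Import Order.TTheory GRing.Theory Num.Theory.

Local Open Scope ring_scope.

(* [laurent R] is R[v, v^-1].  The additive structure is that of the finitely
   supported functions int -> R; the convolution product has to be added, since
   the ring structure of [monalg] excludes exponents with a nontrivial inverse. *)
Definition laurent (R : comNzRingType) : Type := {malg R[int]}.

HB.instance Definition _ (R : comNzRingType) :=
  GRing.Lmodule.copy (laurent R) {malg R[int]}.

Section LaurentRing.
Variable R : comNzRingType.
Implicit Types p q : laurent R.

Definition lsupp p : {fset int} := msupp p.
Definition lcoef p (n : int) : R := mcoeff n p.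
Definition lmono (c : R) (n : int) : laurent R := mkmalgU n c.
Definition lone : laurent R := lmono 1 0.
Definition lmul p q : laurent R :=
  \sum_(m <- lsupp p) \sum_(n <- lsupp q) lmono (lcoef p m * lcoef q n) (m + n).

Lemma lcoefP p q : (forall n, lcoef p n = lcoef q n) -> p = q.
Proof. by move=> e; apply/malgP. Qed.

Lemma lcoefD p q n : lcoef (p + q) n = lcoef p n + lcoef q n.
Proof. exact: mcoeffD. Qed.

Lemma lcoef_mono c m n : lcoef (lmono c m) n = c *+ (m == n).
Proof. exact: mcoeffU. Qed.

Lemma lcoef_neq0 p n : (lcoef p n != 0) = (n \in lsupp p).
Proof. exact: mcoeff_neq0. Qed.

Lemma lmono0 n : lmono 0 n = 0.
Proof. exact: monalgU0. Qed.

Lemma lmonoD n c d : lmono (c + d) n = lmono c n + lmono d n.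
Proof. exact: monalgUD. Qed.

Lemma lsum p : p = \sum_(n <- lsupp p) lmono (lcoef p n) n.
Proof. exact: monalgE. Qed.

Lemma lmulw (d1 d2 : {fset int}) p q :
  (lsupp p `<=` d1)%fset -> (lsupp q `<=` d2)%fset ->
  lmul p q =
    \sum_(m <- d1) \sum_(n <- d2) lmono (lcoef p m * lcoef q n) (m + n).
Proof.
move=> le1 le2; rewrite /lmul (big_fset_incl _ le1) /=.
  apply/eq_bigr => k1 _; apply/big_fset_incl => // k _ /mcoeff_outdom E.
  by rewrite [lcoef q k]E mulr0 lmono0.
move=> k _ /mcoeff_outdom E.
by rewrite big1 // => k' _; rewrite [lcoef p k]E mul0r lmono0.
Qed.

Lemma lmulDl : left_distributive lmul +%R.
Proof.
move=> p q r.
rewrite (lmulw (msuppD_le p q) (fsubset_refl _)).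
rewrite (lmulw (fsubsetUl (lsupp p) (lsupp q)) (fsubset_refl (lsupp r))).
rewrite (lmulw (fsubsetUr (lsupp p) (lsupp q)) (fsubset_refl (lsupp r))).
rewrite -big_split /=; apply/eq_bigr => m _.
rewrite -big_split /=; apply/eq_bigr => n _.
by rewrite lcoefD mulrDl lmonoD.
Qed.

Lemma lmulC : commutative lmul.
Proof.
move=> p q; rewrite /lmul exchange_big /=.
by apply/eq_bigr => m _; apply/eq_bigr => n _; rewrite mulrC addrC.
Qed.

Lemma lmulDr : right_distributive lmul +%R.
Proof. by move=> p q r; rewrite !(lmulC p) lmulDl. Qed.

Lemma lmul0 : left_zero 0 lmul.
Proof. by move=> p; apply: (addrI (lmul 0 p)); rewrite -lmulDl !addr0. Qed.

Lemma lmulr0 : right_zero 0 lmul.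
Proof. by move=> p; rewrite lmulC lmul0. Qed.

Lemma lmulUU c d m n : lmul (lmono c m) (lmono d n) = lmono (c * d) (m + n).
Proof.
rewrite (lmulw (d1 := [fset m]%fset) (d2 := [fset n]%fset)) ?msuppU_le //.
by rewrite !big_seq_fset1 !lcoef_mono !eqxx !mulr1n.
Qed.

Lemma lmul_suml (I : Type) (s : seq I) (F : I -> laurent R) q :
  lmul (\sum_(i <- s) F i) q = \sum_(i <- s) lmul (F i) q.
Proof. exact: (big_morph (lmul^~ q) (fun x y => lmulDl x y q) (lmul0 q)). Qed.

Lemma lmul_sumr (I : Type) (s : seq I) (F : I -> laurent R) q :
  lmul q (\sum_(i <- s) F i) = \sum_(i <- s) lmul q (F i).
Proof. exact: (big_morph (lmul q) (lmulDr q) (lmulr0 q)). Qed.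

Lemma lmulA : associative lmul.
Proof.
move=> p q r; rewrite [p]lsum !lmul_suml; apply/eq_bigr => i _.
rewrite [q]lsum lmul_suml !lmul_sumr lmul_suml; apply/eq_bigr => j _.
rewrite [r]lsum !lmul_sumr; apply/eq_bigr => k _.
by rewrite !lmulUU mulrA addrA.
Qed.

Lemma lmul1 : left_id lone lmul.
Proof.
move=> p; rewrite {1}[p]lsum lmul_sumr [RHS]lsum; apply/eq_bigr => n _.
by rewrite lmulUU mul1r add0r.
Qed.

Lemma lone_neq0 : lone != 0.
Proof.
apply/eqP => /(congr1 (lcoef^~ 0)) /eqP.
by rewrite lcoef_mono eqxx mulr1n [lcoef 0 0]mcoeff0 oner_eq0.
Qed.

End LaurentRing.

HB.instance Definition _ (R : comNzRingType) :=
  GRing.Zmodule_isComNzRing.Build (laurent R)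
    (@lmulA R) (@lmulC R) (@lmul1 R) (@lmulDl R) (@lone_neq0 R).

Section LaurentOps.
Variable R : comNzRingType.
Implicit Types p : laurent R.

Definition vpow (n : int) : laurent R := lmono 1 n.

(* v |-> v^-1 *)
Definition lbar p : laurent R := \sum_(n <- lsupp p) lmono (lcoef p n) (- n).

(* p belongs to v^n R[v^-1] *)
Definition deg_le p (n : int) : bool := all (fun k => k <= n) (lsupp p).

(* The largest exponent occurring in p (0 if p = 0). *)
Definition ldeg p : int :=
  \big[Num.max/head 0 (lsupp p)]_(n <- lsupp p) n.

Lemma deg_leP p n :
  reflect (forall k, n < k -> lcoef p k = 0) (deg_le p n).
Proof.
apply: (iffP allP) => [H k nk | H k]; last first.
  by rewrite -lcoef_neq0 => pk; rewrite leNgt; apply: contra pk => /H ->.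
by apply/eqP; apply: contraLR nk; rewrite lcoef_neq0 -leNgt => /H.
Qed.

Lemma ldegP p : p != 0 -> lcoef p (ldeg p) != 0 /\ deg_le p (ldeg p).
Proof.
move=> p0; have /fset0Pn [x] : lsupp p != fset0.
  by apply: contra_neq p0 => E; rewrite [p]lsum E big_seq_fset0.
have E k : (k \in lsupp p) = (k \in enum_fset (lsupp p)) by [].
rewrite lcoef_neq0 !E /deg_le /ldeg.
case: (enum_fset (lsupp p)) => // y s _ /=; split; last first.
  by apply/(@allP _ _ (y :: s)) => k ks; exact: (le_bigmax_seq y k xpredT id ks).
rewrite big_seq; elim/big_ind: _ => // [|a b ha hb]; first exact: mem_head.
by rewrite maxEle; case: ifP.
Qed.

End LaurentOps.

Arguments vpow {R} n.

(* The embeddings of Z[v, v^-1] into Z[v, v^-1][v', v'^-1]. *)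
Definition in_v (p : laurent int) : laurent (laurent int) := lmono p 0.
Definition in_v' (p : laurent int) : laurent (laurent int) :=
  \sum_(n <- lsupp p) lmono (lmono (lcoef p n) 0) n.

Section Coxeter.
Variable gT : finGroupType.
Implicit Types (W S : {set gT}) (L : gT -> nat).

(* W is presented by the generators S and the relations (s t)^m(s,t) = 1, where
   m(s, t) is the order of s t. *)
Record coxeter_system W S : Prop := CoxeterSystem {
  coxeter_gen : <<S>>%g = W;
  coxeter_order : {in S, forall s, #[s]%g = 2};
  coxeter_presentation : forall (hT : groupType) (f : gT -> hT),
    {in S &, forall s t, (f s * f t) ^+ #[s * t] = 1}%g ->
    exists phi : gT -> hT,
      {in W &, {morph phi : x y / (x * y)%g}} /\ {in S, phi =1 f}
}.

Lemma word_exists S w : exists n, (w \in <<S>>%g) ==> (w \in S ^+ n)%g.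
Proof.
have [/gen_prodgP[n [f Sf ->]] | _] := boolP (w \in <<S>>%g); last by exists 0%N.
exists n; rewrite -[n in (S ^+ n)%g]card_ord -prodg_const.
by apply: mem_prodg => i _; apply: Sf.
Qed.

(* S ^+ n is the set of products of n elements of S. *)
Definition length S w : nat := ex_minn (word_exists S w).

Definition weight_function W S L : Prop :=
  {in W &, forall x y,
    length S (x * y)%g = (length S x + length S y)%N ->
    L (x * y)%g = (L x + L y)%N}.

Definition longest W S : gT := [arg max_(w > 1%g in W) length S w].

(* b restricted to W is an R-basis of V, with coordinate functions [co]. *)
Record is_basis (R : nzRingType) (V : lmodType R) W
    (b : gT -> V) (co : V -> gT -> R) : Prop := IsBasis {
  basis_span : forall h, h = \sum_(x in W) co h x *: b x;
  basis_coord : forall (f : gT -> R) x, x \in W ->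
    co (\sum_(y in W) f y *: b y) x = f x
}.

(* The Hecke algebra of (W, S, L) with its bar involution, its automorphism
   dagger and its basis c.  [Tinv x] is the inverse of T_x. *)
Record hecke W S L : Type := Hecke {
  hecke_alg :> algType (laurent int);

  T : gT -> hecke_alg;
  Tcoord : hecke_alg -> gT -> laurent int;
  T_basis : is_basis W T Tcoord;
  T_mul : {in W &, forall x y,
    length S (x * y)%g = (length S x + length S y)%N ->
    T x * T y = T (x * y)%g};
  T_quad : {in S, forall s,
    (T s - (vpow (L s)%:Z)%:A) * (T s + (vpow (- (L s)%:Z))%:A) = 0};

  Tinv : gT -> hecke_alg;
  T_mulV : {in W, forall x, T x * Tinv x = 1};
  T_mulVl : {in W, forall x, Tinv x * T x = 1};

  bar : {rmorphism hecke_alg -> hecke_alg};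
  bar_involutive : involutive bar;
  bar_scale : forall a h, bar (a *: h) = lbar a *: bar h;
  bar_T : {in W, forall x, bar (T x) = Tinv x^-1%g};

  dagger : {lrmorphism hecke_alg -> hecke_alg};
  dagger_bijective : bijective dagger;
  dagger_T : {in W, forall x,
    dagger (T x) = (-1) ^+ length S x *: Tinv x^-1%g};

  c : gT -> hecke_alg;
  ccoord : hecke_alg -> gT -> laurent int;
  c_basis : is_basis W c ccoord;
  c_bar : {in W, forall x, bar (c x) = c x};
  c_diag : {in W, forall x, Tcoord (c x) x = 1};
  c_offdiag : {in W &, forall x y, y != x -> deg_le (Tcoord (c x) y) (-1)}
}.

End Coxeter.

Section Cells.
Variables (gT : finGroupType) (W S : {set gT}) (L : gT -> nat).
Variable H : hecke W S L.

Definition p_coef (y x : gT) : laurent int := Tcoord (c H x) y.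
Definition h_coef (x y z : gT) : laurent int := ccoord (c H x * c H y) z.

Definition le_L_gen : rel gT := fun w w' =>
  [&& w \in W, w' \in W & [exists s in S, h_coef s w' w != 0]].
Definition le_L : rel gT := connect le_L_gen.
Definition le_R : rel gT := fun w w' => le_L w^-1%g w'^-1%g.
Definition le_LR : rel gT := connect (fun w w' => le_L w w' || le_R w w').

Definition sim_L : rel gT := fun x y => le_L x y && le_L y x.
Definition sim_R : rel gT := fun x y => le_R x y && le_R y x.
Definition sim_LR : rel gT := fun x y => le_LR x y && le_LR y x.
Definition lt_LR : rel gT := fun x y => le_LR x y && ~~ sim_LR x y.

Definition left_cell (C : {set gT}) : Prop :=
  exists2 x, x \in W & C = [set y in W | sim_L x y].
Definition two_sided_cell (C : {set gT}) : Prop :=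
  exists2 x, x \in W & C = [set y in W | sim_LR x y].

(* The submodule H^{< C}. *)
Definition below_cell (C : {set gT}) (h : H) : Prop :=
  exists f : gT -> laurent int,
    h = \sum_(x in W | [exists x' in C, lt_LR x x']) f x *: dagger H (c H x).

Lemma a_bound z :
  exists n : nat, [forall x in W, forall y in W, deg_le (h_coef x y z) n%:Z].
Proof.
exists (\max_x \max_y \max_(k <- lsupp (h_coef x y z)) `|k|%N)%N.
apply/forall_inP => x _; apply/forall_inP => y _; apply/allP => k hk.
apply: (le_trans (ler_norm k)); rewrite -abszE lez_nat.
apply: leq_trans (leq_bigmax x); apply: leq_trans (leq_bigmax y).
exact: (@leq_bigmax_seq _ _ xpredT (fun k : int => `|k|%N)).
Qed.

Definition a_fun (z : gT) : nat := ex_minn (a_bound z).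

Definition gamma (x y z : gT) : int :=
  lcoef (h_coef x y z^-1%g) (a_fun z^-1%g)%:Z.

Definition Delta (z : gT) : int := - ldeg (p_coef 1%g z).
Definition n_coef (z : gT) : int := lcoef (p_coef 1%g z) (- Delta z).
Definition distinguished : {set gT} :=
  [set z in W | (a_fun z)%:Z == Delta z].

(* u |-> eps_u c_{u*}^dagger describes the action of v^(a - a') T_{w_0} on the
   c_u^dagger, u in C, modulo H^{< C}. *)
Definition longest_acts (C : {set gT}) (a a' : nat)
    (star : gT -> gT) (eps : gT -> int) : Prop :=
  {in C, forall u, (eps u = 1 \/ eps u = -1) /\
    below_cell C
      (vpow (a%:Z - a'%:Z) *: (T H (longest W S) * dagger H (c H u))
       - (eps u)%:~R *: dagger H (c H (star u)))}.

End Cells.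

Section Properties.
Variables (gT : finGroupType) (W S : {set gT}) (L : gT -> nat).
Variable H : hecke W S L.

Local Notation a := (a_fun H).
Local Notation gamma := (gamma H).
Local Notation h := (h_coef H).
Local Notation D := (distinguished H).

Record P1_to_P15 : Prop := {
  P1 : {in W, forall z, (a z)%:Z <= Delta H z};
  P2 : {in D & W & W, forall d x y, gamma x y d != 0 -> x = y^-1%g};
  P3 : {in W, forall y, exists! d, d \in D /\ gamma y^-1%g y d != 0};
  P4 : {in W &, forall z' z, le_LR H z' z -> (a z <= a z')%N};
  P5 : {in D & W, forall d y, gamma y^-1%g y d != 0 ->
    gamma y^-1%g y d = n_coef H d /\ (n_coef H d = 1 \/ n_coef H d = -1)};
  P6 : {in D, forall d, (d * d)%g = 1%g};
  P7 : {in W & W & W, forall x y z, gamma x y z = gamma y z x};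
  P8 : {in W & W & W, forall x y z, gamma x y z != 0 ->
    [/\ sim_L H x y^-1%g, sim_L H y z^-1%g & sim_L H z x^-1%g]};
  P9 : {in W &, forall z' z, le_L H z' z -> a z' = a z -> sim_L H z' z};
  P10 : {in W &, forall z' z, le_R H z' z -> a z' = a z -> sim_R H z' z};
  P11 : {in W &, forall z' z, le_LR H z' z -> a z' = a z -> sim_LR H z' z};
  P12 : forall (I : {set gT}) (HI : hecke <<I>>%g I L),
    I \subset S -> {in <<I>>%g, forall y, a_fun HI y = a y};
  P13 : forall C, left_cell H C ->
    (exists! d, d \in C :&: D) /\
    {in C & C :&: D, forall x d, gamma x^-1%g x d != 0};
  P14 : {in W, forall z, sim_LR H z z^-1%g};
  P15 : forall w y x x', w \in W -> y \in W -> x \in W -> x' \in W ->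
    a w = a y ->
    \sum_(y' in W) in_v' (h w x' y') * in_v (h x y' y) =
    \sum_(y' in W) in_v (h x w y') * in_v' (h y' x' y)
}.

End Properties.

(* Main.v *)
Require Import Defs.
From mathcomp Require Import all_boot all_order all_algebra all_fingroup.
From mathcomp Require Import finmap.
From mathcomp Require Import zify.

Set Implicit Arguments.
Unset Strict Implicit.
Unset Printing Implicit Defensive.

Import Order.TTheory GRing.Theory Num.Theory.
Local Open Scope ring_scope.

(** Write [T0] for [T_w0] and [bar] for the bar involution, and let
    [M(z, u)], for [z, u] in the two-sided cell, be the coefficient of [c_z] in
    [T0 c_u], up to a fixed sign. The claim is that
    [Y = v^(a' - a) M] is a signed permutation matrix which is an involution.
    It suffices that [Y] has integer entries, is symmetric and has square [1]:
    then each column has its sum of squares equal to one, hence a single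
    nonzero entry, which is a sign.

    - Square one. The inverse of [T0] is [bar T0], so the inverse of [M] is its
      image under [v |-> v^-1]; once [Y] is constant in [v], it is its own inverse
      ([cell_matrix_sq]).

    - Integrality. The inversion formula expresses [T0] as the sum of the
      [+-p_(1, w0 y) c_y], so that [M(z, u)] is the sum of the
      [+-p_(1, w0 y) h_(y, u, z)]. If [h_(y, u, z)] is nonzero, then [z] is below
      [y] for the right preorder, so [w0 y] is below [w0 z] and
      [a(w0 y) >= a(w0 z) = a'] by P4. Together with P1 this bounds the degree of every
      term by [a - a'] ([longest_coef_deg]). The same bound on the cell
      [w0 C], whose cell module is dual to that of [C] up to the twist by
      [dagger], bounds the order from below ([longest_coef_cell]).

    - Symmetry. Comparing coefficients of [v^(a - a')] gives [Y(z, u)] as a sum of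
      [n_y gamma(y, u, z^-1)], where [n_y = n_(y^-1)]. The anti-automorphism
      [T_x |-> T_(x^-1)] and the cyclicity P7 of [gamma] turn it into the sum of
      the [n_y gamma(y^-1, z, u^-1)], which is [Y(u, z)] ([cell_matrix_sym]).

    The remaining identities are symmetries of [Y] under [sigma], which is
    conjugation by [T0], and under the anti-automorphism; [sigma] preserves the
    cell because [c_u*] occurs in [T0 c_u = c_(sigma u) T0].

    Both the inversion formula and the duality between [C] and [w0 C] come from the
    trace form [(h, k) |-> coefficient of T_1 in h k]: the basis dual to [c] consists
    of the [+-T0 dagger(c_(w0 z))], up to inversion of [z] ([dual_pairing]).

    The combinatorics of [w0] is drawn from the Hecke algebra too. The exchange
    property follows from associativity of [T_s T_w T_t] and the linear
    independence of the [T_x] ([fold_eq]), and [l(w0 x) = l(w0) - l(x)] follows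
    from it by way of the 0-Hecke monoid ([no_ascent_longest]). *)

(** * Laurent polynomials *)

Section Laurent.
Implicit Types (p q : laurent int) (m n : int).

Lemma lcoef0 n : lcoef (0 : laurent int) n = 0.
Proof. by rewrite -(lmono0 int 0) lcoef_mono mul0rn. Qed.

Lemma lcoefN p n : lcoef (- p) n = - lcoef p n.
Proof. by apply: (addrI (lcoef p n)); rewrite -lcoefD !subrr lcoef0. Qed.

Lemma lcoef_sum I (r : seq I) (P : pred I) (F : I -> laurent int) n :
  lcoef (\sum_(i <- r | P i) F i) n = \sum_(i <- r | P i) lcoef (F i) n.
Proof.
by elim/big_rec2: _ => [|i x y _ <-]; rewrite ?lcoef0 ?lcoefD.
Qed.

Lemma sum_lsupp p (f : int -> int) m :
  (forall k, lcoef p k = 0 -> f k = 0) ->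
  \sum_(k <- lsupp p) f k *+ (k == m) = f m.
Proof.
move=> f0; have [mp | mp] := boolP (m \in lsupp p).
  rewrite (big_rem m) //= eqxx mulr1n big1_seq ?addr0 // => k /andP [_].
  by rewrite mem_rem_uniq ?fset_uniq // inE => /andP [/negPf-> _]; rewrite mulr0n.
rewrite f0; last by apply/eqP; move: mp; rewrite -lcoef_neq0 negbK.
rewrite big1_seq // => k /= kp; case: eqP kp mp => // ->.
by move=> -> .
Qed.

Lemma laurent1 : 1 = lmono 1 0 :> laurent int.
Proof. by []. Qed.


Lemma lmonoM (b d : int) m n : lmono b m * lmono d n = lmono (b * d) (m + n).
Proof. exact: lmulUU. Qed.

Lemma lcoef_lbar p n : lcoef (lbar p) n = lcoef p (- n).
Proof.
rewrite /lbar lcoef_sum -[RHS](@sum_lsupp p (lcoef p)) //.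
by apply: eq_bigr => k _; rewrite lcoef_mono eqr_oppLR.
Qed.

Lemma lcoefM p q n :
  lcoef (p * q) n = \sum_(m <- lsupp p) lcoef p m * lcoef q (n - m).
Proof.
rewrite [p * q]/(lmul p q) /lmul lcoef_sum; apply: eq_bigr => m _.
rewrite lcoef_sum -(@sum_lsupp q (fun k => lcoef p m * lcoef q k)); last first.
  by move=> k ->; rewrite mulr0.
by apply: eq_bigr => k _; rewrite lcoef_mono [k == _]eq_sym subr_eq eq_sym addrC.
Qed.

Lemma deg_le0 n : deg_le (0 : laurent int) n.
Proof. by apply/deg_leP => k _; rewrite lcoef0. Qed.

Lemma deg_leD p q n : deg_le p n -> deg_le q n -> deg_le (p + q) n.
Proof.
move=> /deg_leP pn /deg_leP qn; apply/deg_leP => k nk.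
by rewrite lcoefD pn ?qn ?addr0.
Qed.

Lemma deg_le_sum I (r : seq I) (P : pred I) (F : I -> laurent int) n :
  (forall i, P i -> deg_le (F i) n) -> deg_le (\sum_(i <- r | P i) F i) n.
Proof. by move=> Fn; elim/big_ind: _ => //; [exact: deg_le0 | move=> x y; exact: deg_leD]. Qed.

Lemma deg_leW p m n : m <= n -> deg_le p m -> deg_le p n.
Proof.
by move=> mn /deg_leP pm; apply/deg_leP => k nk; apply: pm; apply: le_lt_trans nk.
Qed.

Lemma deg_leM p q m n : deg_le p m -> deg_le q n -> deg_le (p * q) (m + n).
Proof.
move=> /allP pm /deg_leP qn; apply/deg_leP => k nk.
rewrite lcoefM big1_seq // => i /= /pm im; rewrite qn ?mulr0 //.
by rewrite ltrBrDl (le_lt_trans _ nk) // lerD2r.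
Qed.

Lemma lcoefM_top p q m n : deg_le p m -> deg_le q n ->
  lcoef (p * q) (m + n) = lcoef p m * lcoef q n.
Proof.
move=> /allP pm /deg_leP qn.
have -> : lcoef p m * lcoef q n = lcoef p m * lcoef q (m + n - m).
  by rewrite addrAC subrr add0r.
rewrite lcoefM -(@sum_lsupp p (fun k => lcoef p k * lcoef q (m + n - k))); last first.
  by move=> k ->; rewrite mul0r.
rewrite big_seq [RHS]big_seq; apply: eq_bigr => i /pm.
rewrite le_eqVlt => /predU1P [-> | im]; first by rewrite eqxx.
by rewrite qn ?mulr0 ?mul0rn // ltrBrDl ltrD2r.
Qed.

Lemma lbar1 : lbar (1 : laurent int) = 1.
Proof.
by apply: lcoefP => n; rewrite lcoef_lbar laurent1 !lcoef_mono eq_sym oppr_eq0 eq_sym.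
Qed.

Lemma lbar_eq0_neg p : lbar p = p -> deg_le p (-1) -> p = 0.
Proof.
move=> pb /deg_leP p0; apply: lcoefP => n; rewrite lcoef0.
case: (ltrP n 0) => n0; last by rewrite p0 // (lt_le_trans _ n0).
by rewrite -pb lcoef_lbar p0 // (@lt_trans _ _ 0) // oppr_gt0.
Qed.

Lemma lcoef_vpow m p n : lcoef (vpow m * p) n = lcoef p (n - m).
Proof.
rewrite mulrC lcoefM -[RHS](@sum_lsupp p (lcoef p)) //.
apply: eq_bigr => k _; rewrite lcoef_mono mulr_natr.
by rewrite [m == _]eq_sym [k == _]eq_sym !subr_eq [m + k]addrC.
Qed.

Lemma lmono_int (b : int) : lmono b 0 = b%:~R.
Proof.
elim/int_ind: b => [|n e|n e]; first by rewrite lmono0.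
  by rewrite intS intrD -e lmonoD.
rewrite intS opprD intrD -e lmonoD mulrN1z; congr (_ + _).
by apply: lcoefP => k; rewrite lcoefN laurent1 !lcoef_mono mulNrn.
Qed.

Lemma deg_le1 : deg_le (1 : laurent int) 0.
Proof.
apply/deg_leP => k k0; rewrite laurent1 lcoef_mono eq_sym.
by rewrite (gt_eqF k0).
Qed.

Lemma deg_le_sign (n : nat) (p : laurent int) (m : int) :
  deg_le p m -> deg_le ((-1) ^+ n * p) m.
Proof.
rewrite -signr_odd mulr_sign; case: odd => // /deg_leP pk.
by apply/deg_leP => i ki; rewrite lcoefN pk ?oppr0.
Qed.

Lemma lbar_mono (b : int) n : lbar (lmono b n) = lmono b (- n).
Proof. by apply: lcoefP => k; rewrite lcoef_lbar !lcoef_mono eqr_oppLR. Qed.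

Lemma lbarN (p : laurent int) : lbar (- p) = - lbar p.
Proof. by apply: lcoefP => n; rewrite lcoef_lbar !lcoefN lcoef_lbar. Qed.

Lemma lbar_sign (n : nat) (p : laurent int) : lbar ((-1) ^+ n * p) = (-1) ^+ n * lbar p.
Proof. by rewrite -signr_odd !mulr_sign; case: odd; rewrite ?lbarN. Qed.

Lemma sign_mul_eq0 (n : nat) (p : laurent int) : ((-1) ^+ n * p == 0) = (p == 0).
Proof. by rewrite -signr_odd mulr_sign; case: odd; rewrite ?oppr_eq0. Qed.

Lemma mulr_neq0_laurent (p q : laurent int) : p * q != 0 -> p != 0 /\ q != 0.
Proof.
by move=> ne; split; apply: contra_neq ne => ->; rewrite ?mul0r ?mulr0.
Qed.

End Laurent.

(** * Coordinates in a basis, and the length function *)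

Section Coordinates.
Variables (gT : finGroupType) (R : nzRingType) (V : lmodType R) (W : {set gT}).
Variables (b : gT -> V) (co : V -> gT -> R) (bas : is_basis W b co).

Lemma coordD h k x : x \in W -> co (h + k) x = co h x + co k x.
Proof.
move=> xW; rewrite {1}[h](basis_span bas) {1}[k](basis_span bas) -big_split /=.
rewrite (eq_bigr (fun x => (co h x + co k x) *: b x)) => [|y _].
  by rewrite (basis_coord bas).
by rewrite scalerDl.
Qed.

Lemma coordZ r h x : x \in W -> co (r *: h) x = r * co h x.
Proof.
move=> xW; rewrite {1}[h](basis_span bas) scaler_sumr.
rewrite (eq_bigr (fun x => (r * co h x) *: b x)) => [|y _].
  by rewrite (basis_coord bas).
by rewrite scalerA.
Qed.

Lemma coord0 x : x \in W -> co 0 x = 0.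
Proof. by move=> xW; rewrite -(scale0r 0) coordZ // mul0r. Qed.

Lemma coordN h x : x \in W -> co (- h) x = - co h x.
Proof. by move=> xW; rewrite -scaleN1r coordZ // mulN1r. Qed.

Lemma coord_sum I (r : seq I) (P : pred I) (F : I -> V) x : x \in W ->
  co (\sum_(i <- r | P i) F i) x = \sum_(i <- r | P i) co (F i) x.
Proof.
by move=> xW; elim/big_rec2: _ => [|i y z _ <-]; rewrite ?coord0 ?coordD.
Qed.

Lemma coord_basis y x : x \in W -> y \in W -> co (b y) x = (x == y)%:R.
Proof.
move=> xW yW; rewrite -(basis_coord bas (fun x => (x == y)%:R) xW).
rewrite (bigD1 y) //= eqxx scale1r big1 ?addr0 // => z /andP [_ /negPf->].
by rewrite scale0r.
Qed.

Lemma coord_inj h k : {in W, forall x, co h x = co k x} -> h = k.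
Proof.
move=> e; rewrite [h](basis_span bas) [k](basis_span bas).
by apply: eq_bigr => x xW; rewrite e.
Qed.

End Coordinates.

Section Length.
Variables (gT : finGroupType) (W S : {set gT}).
Hypothesis coxW : coxeter_system W S.
Local Open Scope group_scope.

Let genS : <<S>> = W := coxeter_gen coxW.

Lemma coxeter1 : 1 \in W. Proof. by rewrite -genS group1. Qed.

Lemma coxeterM x y : x \in W -> y \in W -> x * y \in W.
Proof. by rewrite -genS; apply: groupM. Qed.

Lemma coxeterV x : (x^-1 \in W) = (x \in W).
Proof. by rewrite -genS groupV. Qed.

Lemma coxeterMl x y : x \in W -> (x * y \in W) = (y \in W).
Proof. by rewrite -genS; apply: groupMl. Qed.

Lemma coxeterMr x y : x \in W -> (y * x \in W) = (y \in W).
Proof. by rewrite -genS; apply: groupMr. Qed.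

Lemma simple_in s : s \in S -> s \in W.
Proof. by rewrite -genS; apply: mem_gen. Qed.

Lemma simple_sq s : s \in S -> s * s = 1.
Proof. by move=> sS; rewrite -[RHS](expg_order s) (coxeter_order coxW). Qed.

Lemma simpleV s : s \in S -> s^-1 = s.
Proof. by move=> /simple_sq ss; apply: (mulgI s); rewrite mulgV ss. Qed.

Lemma simpleK s x : s \in S -> s * (s * x) = x.
Proof. by move=> sS; rewrite mulgA simple_sq // mul1g. Qed.

Lemma simpleKr s x : s \in S -> x * s * s = x.
Proof. by move=> sS; rewrite -mulgA simple_sq // mulg1. Qed.

Lemma length_word w : w \in W -> w \in S ^+ length S w.
Proof. by rewrite -genS /length; case: ex_minnP => n /implyP. Qed.

Lemma length_min w n : w \in S ^+ n -> (length S w <= n)%N.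
Proof.
by move=> wn; rewrite /length; case: ex_minnP => m _; apply; apply/implyP.
Qed.

Lemma length1 : length S 1 = 0%N.
Proof. by apply/eqP; rewrite -leqn0 length_min // expg0 set11. Qed.

Lemma length_eq0 w : w \in W -> length S w = 0%N -> w = 1.
Proof. by move=> /length_word /[swap] ->; rewrite expg0 => /set1P. Qed.

Lemma leq_lengthM x y : x \in W -> y \in W ->
  (length S (x * y)%g <= length S x + length S y)%N.
Proof.
by move=> xW yW; apply: length_min; rewrite expgD; apply: mem_mulg; apply: length_word.
Qed.

Lemma leq_lengthV x : x \in W -> (length S x^-1%g <= length S x)%N.
Proof.
move=> /length_word; move: (length S x) => n xn; apply: length_min; move: xn.
elim: n x => [|n IH] x; first by rewrite !expg0 => /set1P->; rewrite invg1 set11.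
rewrite {1}expgS expgSr => /mulsgP [s y sS yn ->]; rewrite invMg (simpleV sS).
by apply: mem_mulg => //; apply: IH.
Qed.

Lemma lengthV x : x \in W -> length S x^-1 = length S x.
Proof.
move=> xW; apply/eqP; rewrite eqn_leq leq_lengthV //=.
by rewrite -{1}[x]invgK leq_lengthV ?coxeterV.
Qed.

Lemma length_split w n : w \in W -> length S w = n.+1 ->
  exists s w', [/\ s \in S, w' \in W, w = s * w' & length S w' = n].
Proof.
move=> wW wn; have := length_word wW; rewrite wn expgS => /mulsgP [s y sS yn e].
exists s, y; have yW : y \in W by rewrite -(coxeterMl y (simple_in sS)) -e.
split=> //; apply/eqP; rewrite eqn_leq length_min //=.
have := leq_lengthM (simple_in sS) yW; rewrite -e wn => h.
rewrite -ltnS (leq_trans h) // -add1n leq_add2r length_min // expg1 //.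
Qed.

Lemma length_simple s : s \in S -> length S s = 1%N.
Proof.
move=> sS; apply/eqP; rewrite eqn_leq length_min ?expg1 //= lt0n; apply/eqP.
move=> /(length_eq0 (simple_in sS)) s1; have := coxeter_order coxW sS.
by rewrite s1 order1.
Qed.

(** The relations have even length, so the presentation provides the sign
    character and with it the parity of the length. *)
Lemma length_parity : exists sgn : gT -> bool,
  {in W &, forall x y, sgn (x * y) = sgn x (+) sgn y} /\ {in S, forall s, sgn s}.
Proof.
pose t : {perm bool} := tperm true false.
have tt : t * t = 1 by rewrite -expg2 /t; apply/permP => -[]; rewrite !permE /= ?permE.
have [|phi [phiM phiS]] := @coxeter_presentation _ _ _ coxW {perm bool} (fun=> t).
  by move=> s r _ _; rewrite tt expg1n.
exists (fun x => odd_perm (phi x)); split=> [x y xW yW | s sS].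
  by rewrite phiM // odd_permM.
by rewrite phiS // odd_tperm.
Qed.

Lemma odd_lengthM x y : x \in W -> y \in W ->
  odd (length S (x * y)) = odd (length S x) (+) odd (length S y).
Proof.
have [sgn [sgnM sgnS]] := length_parity.
have e z : z \in W -> odd (length S z) = sgn z.
  move zn: (length S z) => n zW; elim: n z zn zW => [|n IH] z zn zW.
    have := sgnM _ _ coxeter1 coxeter1.
    by rewrite (length_eq0 zW zn) mulg1; case: (sgn 1).
  have [s [u [sS uW e un]]] := length_split zW zn.
  by rewrite e /= (IH u) // sgnM ?(simple_in sS) // (sgnS s).
by move=> xW yW; rewrite (e x) ?(e y) ?(e (x * y)) ?sgnM ?coxeterM.
Qed.

Lemma length_mul_simple s w : s \in S -> w \in W ->
  length S (s * w) = (length S w).+1 \/ length S w = (length S (s * w)).+1.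
Proof.
move=> sS wW; have sW := simple_in sS; have swW := coxeterM sW wW.
have := leq_lengthM sW wW; have := leq_lengthM sW swW.
have := odd_lengthM sW wW; rewrite simpleK // (length_simple sS).
move: (length S w) (length S (s * w)) => m n.
rewrite !add1n leq_eqVlt => o /predU1P [-> | mn]; first by right.
rewrite leq_eqVlt => /predU1P [-> | nm]; first by left.
suff nm' : n = m by move: o; rewrite nm'; case: (odd m).
by apply/eqP; rewrite eqn_leq -ltnS nm -ltnS mn.
Qed.

Lemma length_mulr_simple s w : s \in S -> w \in W ->
  length S (w * s) = (length S w).+1 \/ length S w = (length S (w * s)).+1.
Proof.
move=> sS wW; have sW := simple_in sS.
have e : s * w^-1 = (w * s)^-1 by rewrite invMg (simpleV sS).
have := @length_mul_simple s w^-1 sS; rewrite coxeterV => /(_ wW).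
by rewrite e !lengthV ?coxeterM.
Qed.

End Length.

Local Opaque length.

(** * Products of standard basis elements *)

Section HeckeProducts.
Variables (gT : finGroupType) (W S : {set gT}) (L : gT -> nat).
Variable H : hecke W S L.
Hypothesis coxW : coxeter_system W S.
Hypothesis L_gt0 : {in S, forall s, (0 < L s)%N}.
Local Notation T := (T H).
Local Notation len := (length S).

Let W1 : 1%g \in W := coxeter1 coxW.

Definition xi (s : gT) : laurent int := vpow (L s)%:Z - vpow (- (L s)%:Z).

Lemma xi_neq0 s : s \in S -> xi s != 0.
Proof.
move=> /L_gt0; rewrite /xi; case: (L s) => // n _.
apply/eqP => /(congr1 (fun p : laurent int => lcoef p n.+1%:Z)) /eqP.
by rewrite lcoefD lcoefN lcoef0 !lcoef_mono eqxx.
Qed.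

Lemma T1 : T 1%g = 1.
Proof.
have e : T 1%g * T 1%g = T 1%g by rewrite (T_mul H) ?mulg1 // length1.
by rewrite -[LHS](mulr1) -(T_mulV H W1) mulrA e (T_mulV H W1).
Qed.

Lemma T_sq s : s \in S -> T s * T s = 1 + xi s *: T s.
Proof.
move=> sS; have := T_quad H sS; rewrite mulrDr !mulrBl -!scalerAr -!scalerAl.
rewrite !mulr1 !mul1r scalerA => /eqP; rewrite addrACA -opprD addrC.
have -> : vpow (- (L s)%:Z) * vpow (L s)%:Z = 1 :> laurent int.
  apply: lcoefP => n; rewrite lcoef_vpow opprK laurent1 !lcoef_mono.
  by rewrite [(L s)%:Z == _]eq_sym [in RHS]eq_sym -subr_eq0 addrK.
rewrite scale1r addrC subr_eq0 => /eqP e.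
apply: (addIr (vpow (- (L s)%:Z) *: T s)); rewrite e /xi scalerBl.
by rewrite addrA subrK addrC.
Qed.

Lemma T_up s w : s \in S -> w \in W -> len (s * w)%g = (len w).+1 ->
  T s * T w = T (s * w)%g.
Proof.
by move=> sS wW e; rewrite (T_mul H) ?(simple_in coxW sS) // e (length_simple coxW sS).
Qed.

Lemma T_upr s w : s \in S -> w \in W -> len (w * s)%g = (len w).+1 ->
  T w * T s = T (w * s)%g.
Proof.
move=> sS wW e; rewrite (T_mul H) ?(simple_in coxW sS) // e (length_simple coxW sS).
by rewrite addn1.
Qed.

Lemma T_down s w : s \in S -> w \in W -> len w = (len (s * w)%g).+1 ->
  T s * T w = T (s * w)%g + xi s *: T w.
Proof.
move=> sS wW e; have swW : (s * w)%g \in W by rewrite (coxeterMl coxW) ?(simple_in coxW sS).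
rewrite -{1}[w](simpleK coxW w sS) -T_up ?(simpleK coxW) //.
rewrite mulrA T_sq // mulrDl mul1r -scalerAl T_up // ?(simpleK coxW) //.
Qed.

Lemma T_downr s w : s \in S -> w \in W -> len w = (len (w * s)%g).+1 ->
  T w * T s = T (w * s)%g + xi s *: T w.
Proof.
move=> sS wW e; have swW : (w * s)%g \in W by rewrite (coxeterMr coxW) ?(simple_in coxW sS).
rewrite -{1}[w](simpleKr coxW w sS) -T_upr ?(simpleKr coxW) //.
rewrite -mulrA T_sq // mulrDr mulr1 -scalerAr T_upr // ?(simpleKr coxW) //.
Qed.

(** The folding condition, from which all exchange properties follow: bracketing
    [T_s T_w T_t] in two ways gives [T_swt + xi_t T_sw] and [T_swt + xi_s T_wt]. *)
Lemma fold_eq s w t : s \in S -> t \in S -> w \in W ->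
  len (s * w)%g = (len w).+1 -> len (w * t)%g = (len w).+1 ->
  len (s * w * t)%g = len w -> (s * w)%g = (w * t)%g.
Proof.
move=> sS tS wW sw wt swt; have sW := simple_in coxW sS.
have tW := simple_in coxW tS.
have swW : (s * w)%g \in W by rewrite (coxeterMl coxW).
have wtW : (w * t)%g \in W by rewrite (coxeterMl coxW).
have := mulrA (T s) (T w) (T t).
rewrite (T_up sS wW sw) (T_upr tS wW wt) (T_down sS wtW) ?(T_downr tS swW) ?mulgA ?sw ?wt ?swt //.
move=> /addrI /(congr1 (fun h => Tcoord h (s * w)%g)).
rewrite !(coordZ (T_basis H)) // !(coord_basis (T_basis H)) // eqxx mulr1.
case: (eqVneq (s * w)%g (w * t)%g) => // _ /eqP.
by rewrite mulr0 eq_sym (negPf (xi_neq0 tS)).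
Qed.

End HeckeProducts.

(** * The longest element *)

Section LongestElement.
Variables (gT : finGroupType) (W S : {set gT}).
Hypothesis coxW : coxeter_system W S.
Local Open Scope group_scope.
Local Notation len := (length S).
Hypothesis fold_eqW : forall s w t, s \in S -> t \in S -> w \in W ->
  len (s * w) = (len w).+1 -> len (w * t) = (len w).+1 ->
  len (s * w * t) = len w -> s * w = w * t.

Let W1 : 1 \in W := coxeter1 coxW.
Let SW s : s \in S -> s \in W := @simple_in _ _ _ coxW s.
Let WM x y : x \in W -> y \in W -> x * y \in W := @coxeterM _ _ _ coxW x y.

(** Left and right multiplication by a generator in the 0-Hecke monoid, whose product
    is the Demazure product. *)
Definition dl s w := if (len w < len (s * w)%g)%N then s * w else w.
Definition dr w t := if (len w < len (w * t)%g)%N then w * t else w.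

Lemma dlW s w : s \in S -> w \in W -> dl s w \in W.
Proof. by rewrite /dl => sS wW; case: ifP => // _; apply: WM => //; apply: SW. Qed.

Lemma drW w t : t \in S -> w \in W -> dr w t \in W.
Proof. by rewrite /dr => tS wW; case: ifP => // _; apply: WM => //; apply: SW. Qed.

(** Associativity of the 0-Hecke product. The case that needs an argument is that
    of [s w] and [w t] both longer than [w], with [s w t] of the same length as [w];
    there the folding condition says [s w = w t]. *)
Lemma dl_drC s w t : s \in S -> t \in S -> w \in W ->
  dr (dl s w) t = dl s (dr w t).
Proof.
move=> sS tS wW; have swW := WM (SW sS) wW; have wtW := WM wW (SW tS).
have h1 := length_mul_simple coxW sS wW.
have h2 := length_mulr_simple coxW tS wW.
have h3 := length_mul_simple coxW sS wtW.
have h4 := length_mulr_simple coxW tS swW.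
have e3 : s * (w * t) = s * w * t by rewrite mulgA.
rewrite e3 in h3; rewrite /dl /dr.
case: (ltnP (len w) (len (s * w))) => h5; case: (ltnP (len w) (len (w * t))) => h6;
  rewrite ?e3.
- have [e | ne] := eqVneq (len (s * w * t)) (len w).
    have sw : len (s * w) = (len w).+1 by case: h1 => // h1; move: h5; rewrite h1 ltnNge leqnSn.
    have wt : len (w * t) = (len w).+1 by case: h2 => // h2; move: h6; rewrite h2 ltnNge leqnSn.
    by rewrite e sw wt !(leq_gtF (leqnSn _)); exact: (fold_eqW sS tS wW sw wt e).
  by case: ltnP => h7; case: ltnP => h8 //; case/eqP: ne; lia.
- by case: ltnP => h7; case: ltnP => h8 //; lia.
- by case: ltnP => h7 //; lia.
- by case: ltnP => h7 //; lia.
Qed.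


Lemma word_dl w : w \in W ->
  exists2 r, all [in S] r & foldr dl 1 r = w.
Proof.
move wn: (len w) => n wW; elim: n w wn wW => [|n IH] w wn wW.
  by exists [::]; rewrite // (length_eq0 coxW wW).
have [s [u [sS uW e un]]] := length_split coxW wW wn.
have [r rS ru] := IH u un uW; exists (s :: r); first by rewrite /= sS.
by rewrite /= ru /dl -e un wn leqnn.
Qed.

Lemma word_dr w : w \in W ->
  exists2 r, all [in S] r & foldl dr 1 r = w.
Proof.
move wn: (len w) => n wW; elim: n w wn wW => [|n IH] w wn wW.
  by exists [::]; rewrite // (length_eq0 coxW wW).
have wV : len w^-1 = n.+1 by rewrite (lengthV coxW).
have wVW : w^-1 \in W by rewrite (coxeterV coxW).
have [s [u [sS uW e un]]] := length_split coxW wVW wV.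
have uVW : u^-1 \in W by rewrite (coxeterV coxW).
have [r rS ru] := IH _ (etrans (lengthV coxW uW) un) uVW.
exists (rcons r s); first by rewrite all_rcons rS andbT.
rewrite -cats1 foldl_cat ru /= /dr (lengthV coxW) // un.
have -> : u^-1 * s = w by rewrite -[w]invgK e invMg (simpleV coxW sS).
by rewrite wn leqnn.
Qed.

Lemma foldr_dlW r w : all [in S] r -> w \in W -> foldr dl w r \in W.
Proof. by elim: r => //= s r IH /andP [sS rS] wW; apply: dlW => //; apply: IH. Qed.

Lemma foldr_dl_drC r t w : all [in S] r -> t \in S -> w \in W ->
  dr (foldr dl w r) t = foldr dl (dr w t) r.
Proof.
move=> + tS wW; elim: r => //= s r IH /andP [sS rS].
by rewrite -IH // dl_drC // foldr_dlW.
Qed.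

Lemma foldr_foldl_dlr r q w : all [in S] r -> all [in S] q -> w \in W ->
  foldl dr (foldr dl w r) q = foldr dl (foldl dr w q) r.
Proof.
move=> rS; elim: q w => //= t q IH w /andP [tS qS] wW.
by rewrite -IH ?drW // foldr_dl_drC.
Qed.

Local Notation w0 := (longest W S).

Lemma longest_max : w0 \in W /\ {in W, forall x, (len x <= len w0)%N}.
Proof. by rewrite /longest; case: arg_maxnP. Qed.

Lemma longestW : w0 \in W. Proof. by case: longest_max. Qed.

Lemma leq_length_longest x : x \in W -> (len x <= len w0)%N.
Proof. by case: longest_max => _; apply. Qed.

Let max_descentl w : w \in W -> (forall x, x \in W -> (len x <= len w)%N) ->
  {in S, forall t, dl t w = w}.
Proof. by move=> wW wm t tS; rewrite /dl ltnNge wm // WM // SW. Qed.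

(** In the 0-Hecke monoid an element without right ascent is a left zero,
    while the longest element is a right zero; hence they coincide. *)
Lemma no_ascent_longest w : w \in W ->
  {in S, forall t, (len (w * t)%g <= len w)%N} -> w = w0.
Proof.
move=> wW wt; have [r rS rw] := word_dl wW; have [q qS qw0] := word_dr longestW.
have e := foldr_foldl_dlr rS qS W1; rewrite rw qw0 in e.
have -> : w = foldl dr w q.
  elim: q qS {qw0 e} => //= t q IH /andP [tS qS].
  by rewrite /dr ltnNge wt //= -IH.
rewrite e; elim: r rS {rw e} => //= s r IH /andP [sS rS].
by rewrite IH // max_descentl ?longestW //; apply: leq_length_longest.
Qed.

Lemma max_length_longest w : w \in W -> len w = len w0 -> w = w0.
Proof.
move=> wW e; apply: no_ascent_longest => // t tS.
by rewrite e leq_length_longest // WM // SW.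
Qed.

Lemma longest_sq : w0 * w0 = 1.
Proof.
have e : w0^-1 = w0.
  by apply: max_length_longest; rewrite ?(coxeterV coxW) ?(lengthV coxW) // longestW.
by rewrite -{1}e mulVg.
Qed.

Lemma longestV : w0^-1 = w0.
Proof. by apply: (mulgI w0); rewrite mulgV longest_sq. Qed.

Lemma longestK x : w0 * (w0 * x) = x. Proof. by rewrite mulgA longest_sq mul1g. Qed.
Lemma longestMW x : (w0 * x \in W) = (x \in W).
Proof. exact: (coxeterMl coxW x longestW). Qed.

Lemma longestMrW x : (x * w0 \in W) = (x \in W).
Proof. exact: (coxeterMr coxW x longestW). Qed.

(** The bound [l(w0 x) <= l(w0) - l(x)] goes down from [x = w0]: any other [x] has
    an ascent [x s], and [l(w0 x) <= l(w0 x s) + 1]. *)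
Lemma length_longestM x : x \in W -> (len (w0 * x)%g + len x)%N = len w0.
Proof.
move=> xW; apply/eqP; rewrite eqn_leq; apply/andP; split; last first.
  have := leq_lengthM coxW (_ : w0 * x \in W) (_ : x^-1 \in W).
  by rewrite mulgK (lengthV coxW) // longestMW (coxeterV coxW); apply.
move n_: (len w0 - len x)%N => n; elim: n x xW n_ => [|n IH] x xW n_.
  have -> : x = w0.
    by apply: max_length_longest => //; have := leq_length_longest xW; lia.
  by rewrite longest_sq (length1 S).
have [/exists_inP [s sS h] | /exists_inPn h] :=
  boolP [exists s in S, len x < len (x * s)%g]%N; last first.
  have e : x = w0 by apply: no_ascent_longest => // t /h; rewrite -leqNgt.
  by move: n_; rewrite e subnn.
have sW := SW sS; have xsW := WM xW sW.
have h1 := length_mulr_simple coxW sS xW.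
have h2 := length_mulr_simple coxW sS (etrans (longestMW x) xW).
have e : w0 * (x * s) = w0 * x * s by rewrite mulgA.
have n1 : (len w0 - len (x * s)%g)%N = n by lia.
have := IH _ xsW n1; rewrite e; move: h1 h2 h.
move: (len (w0 * x * s)) (len (w0 * x)) (len (x * s)) => p q r; lia.
Qed.

Lemma length_longestMr x : x \in W -> (len (x * w0)%g + len x)%N = len w0.
Proof.
move=> xW; have := length_longestM (_ : x^-1 \in W); rewrite (coxeterV coxW).
rewrite -{1}longestV -invMg !(lengthV coxW) ?longestMrW //; exact.
Qed.

Lemma length_conj_longest x : x \in W -> len (w0 * x * w0) = len x.
Proof.
move=> xW; apply: (@addIn (len (w0 * x))).
by rewrite (length_longestMr (etrans (longestMW x) xW)) -(length_longestM xW) addnC.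
Qed.

End LongestElement.

(** * The trace form, the bar involution and dagger *)

Section HeckeDuality.
Variables (gT : finGroupType) (W S : {set gT}) (L : gT -> nat).
Variable H : hecke W S L.
Hypothesis coxW : coxeter_system W S.
Hypothesis L_gt0 : {in S, forall s, (0 < L s)%N}.
Local Notation T := (T H).
Local Notation Tinv := (Tinv H).
Local Notation c := (c H).
Local Notation dag := (dagger H).
Local Notation bar := (bar H).
Local Notation len := (length S).
Local Notation w0 := (longest W S).
Implicit Types h k : H.

Let foldW := fold_eq H coxW L_gt0.
Let W1 : 1%g \in W := coxeter1 coxW.
Let w0W : w0 \in W := longestW coxW.
Let SW s : s \in S -> s \in W := @simple_in _ _ _ coxW s.
Let WM x y : x \in W -> y \in W -> (x * y)%g \in W := @coxeterM _ _ _ coxW x y.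
Let WV x : (x^-1%g \in W) = (x \in W) := coxeterV coxW x.

Definition trace h := Tcoord h 1%g.

(** By induction on [x], moving simple reflections over to [y]. *)
Lemma trace_T x y : x \in W -> y \in W ->
  trace (T x * T y) = (x * y == 1)%g%:R.
Proof.
move=> xW; have xVW : x^-1%g \in W by rewrite WV.
move xn: (len x^-1%g) => n; elim: n x xn xW xVW y => [|n IH] x xn xW xVW y yW.
  have -> : x = 1%g by rewrite -[x]invgK (length_eq0 coxW xVW xn) invg1.
  rewrite (T1 H coxW) mul1r mul1g /trace (coord_basis (T_basis H)) //.
  by rewrite eq_sym.
have [s [u [sS uW e un]]] := length_split coxW xVW xn.
have uVW : u^-1%g \in W by rewrite WV.
have ex : x = (u^-1 * s)%g by rewrite -[x]invgK e invMg (simpleV coxW sS).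
have uVn : len u^-1%g = n by rewrite (lengthV coxW).
have syW := WM (SW sS) yW.
have IH' := IH u^-1%g; rewrite invgK in IH'.
have l : len (u^-1 * s)%g = (len u^-1%g).+1 by rewrite -ex uVn -xn (lengthV coxW).
rewrite ex -(T_upr H coxW sS uVW l).
rewrite -mulrA; case: (length_mul_simple coxW sS yW) => h.
  by rewrite (T_up H coxW sS yW h) (IH' un uVW uW _ syW) mulgA.
rewrite (T_down H coxW sS yW h) mulrDr -scalerAr /trace (coordD (T_basis H)) //.
rewrite (coordZ (T_basis H)) // -!/(trace _) (IH' un uVW uW _ syW) (IH' un uVW uW _ yW) mulgA.
have [e2|] := eqVneq (u^-1 * y)%g 1%g; last by rewrite mulr0 addr0.
(* Then [s y = x^-1] is longer than [y], against the case at hand. *)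
have ey : y = u by apply: (mulgI u^-1%g); rewrite e2 mulVg.
by move: h; rewrite ey -e xn un; lia.
Qed.

Lemma trace_mul h k :
  trace (h * k) = \sum_(x in W) Tcoord h x * Tcoord k x^-1%g.
Proof.
rewrite {1}[h](basis_span (T_basis H)) mulr_suml /trace (coord_sum (T_basis H)) //.
apply: eq_bigr => x xW; rewrite -scalerAl (coordZ (T_basis H)) //; congr (_ * _).
rewrite {1}[k](basis_span (T_basis H)) mulr_sumr (coord_sum (T_basis H)) //.
rewrite (bigD1 x^-1%g) ?WV //= -scalerAr (coordZ (T_basis H)) //.
rewrite -/(trace _) trace_T ?WV // mulgV eqxx mulr1 big1 ?addr0 // => y /andP [yW ne].
rewrite -scalerAr (coordZ (T_basis H)) // -/(trace _) trace_T // -eq_invg_mul eq_sym.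
by rewrite (negPf ne) mulr0.
Qed.

Lemma trace_mulC h k : trace (h * k) = trace (k * h).
Proof.
rewrite !trace_mul (reindex_inj invg_inj) /=.
by apply: eq_big => [x | x _]; rewrite ?WV // invgK mulrC.
Qed.

Lemma traceZ a h : trace (a *: h) = a * trace h.
Proof. by rewrite /trace (coordZ (T_basis H)). Qed.

Lemma trace_sum I (r : seq I) (P : pred I) (F : I -> H) :
  trace (\sum_(i <- r | P i) F i) = \sum_(i <- r | P i) trace (F i).
Proof. by rewrite /trace (coord_sum (T_basis H)). Qed.

Lemma T_longestV x : x \in W -> T w0 * Tinv x^-1%g = T (w0 * x)%g.
Proof.
move=> xW; have xVW : x^-1%g \in W by rewrite WV.
have -> : T w0 = T (w0 * x)%g * T x^-1%g.
  rewrite (T_mul H) ?(longestMW coxW) // ?mulgK //.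
  by rewrite (lengthV coxW) // (length_longestM coxW foldW).
by rewrite -mulrA (T_mulV H) // mulr1.
Qed.

Lemma coord_longest h : Tcoord h w0 = trace (T w0 * h).
Proof.
rewrite trace_mul (bigD1 w0) //= (coord_basis (T_basis H)) // eqxx mul1r.
rewrite (longestV coxW foldW) big1 ?addr0 // => x /andP [xW /negPf ne].
by rewrite (coord_basis (T_basis H)) // ne mul0r.
Qed.

Lemma bar_span h : bar h = \sum_(x in W) lbar (Tcoord h x) *: Tinv x^-1%g.
Proof.
rewrite {1}[h](basis_span (T_basis H)) rmorph_sum.
by apply: eq_bigr => x xW; rewrite bar_scale bar_T.
Qed.

(** [bar T_x] has [T_w0]-coordinate [trace (T_w0 * Tinv x^-1) = trace T_(w0 x)],
    so this coordinate, unlike the others, commutes with the bar involution. *)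
Lemma bar_coord_longest h : Tcoord (bar h) w0 = lbar (Tcoord h w0).
Proof.
rewrite coord_longest bar_span mulr_sumr trace_sum (bigD1 w0) //=.
rewrite -scalerAr traceZ T_longestV // (longest_sq coxW foldW).
rewrite /trace (coord_basis (T_basis H)) // eqxx mulr1 big1 ?addr0 //.
move=> x /andP [xW ne]; rewrite -scalerAr -/(trace _) traceZ T_longestV //.
rewrite /trace (coord_basis (T_basis H)) ?(longestMW coxW) //.
rewrite eq_sym -eq_invg_mul (longestV coxW foldW) eq_sym.
by rewrite (negPf ne) mulr0.
Qed.

Lemma bar_Tinv x : x \in W -> bar (Tinv x) = T x^-1%g.
Proof. by move=> xW; rewrite -{1}[x]invgK -bar_T ?WV // bar_involutive. Qed.

Lemma dagger_Tinv x : x \in W -> dag (Tinv x) = (-1) ^+ len x *: T x^-1%g.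
Proof.
move=> xW; have xVW : x^-1%g \in W by rewrite WV.
have e : dag (T x) * ((-1) ^+ len x *: T x^-1%g) = 1.
  rewrite dagger_T // -scalerAl -scalerAr scalerA -expr2 sqrr_sign scale1r.
  by rewrite (T_mulVl H).
rewrite -[LHS]mulr1 -e mulrA -rmorphM (T_mulVl H) // rmorph1 mul1r //.
Qed.

Lemma daggerK h : dag (dag h) = h.
Proof.
rewrite [h](basis_span (T_basis H)) !linear_sum; apply: eq_bigr => x xW.
rewrite !linearZ /= dagger_T // linearZ /= dagger_Tinv ?WV // invgK.
by rewrite (lengthV coxW) // !scalerA -mulrA -expr2 sqrr_sign mulr1.
Qed.

Lemma bar_sign n h : bar ((-1) ^+ n *: h) = (-1) ^+ n *: bar h.
Proof. by rewrite -signr_odd !scaler_sign; case: odd; rewrite ?rmorphN. Qed.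

Lemma bar_dagger h : bar (dag h) = dag (bar h).
Proof.
rewrite [h](basis_span (T_basis H)) linear_sum !rmorph_sum /=.
apply: eq_bigr => x xW.
rewrite linearZ /= !bar_scale linearZ /= dagger_T // bar_sign bar_T // bar_Tinv ?WV //.
by rewrite dagger_Tinv ?WV // (lengthV coxW) // invgK.
Qed.

End HeckeDuality.

(** * The dual basis, the anti-automorphism and conjugation by the longest element *)

Section HeckeDuality.
Variables (gT : finGroupType) (W S : {set gT}) (L : gT -> nat).
Variable H : hecke W S L.
Hypothesis coxW : coxeter_system W S.
Hypothesis L_gt0 : {in S, forall s, (0 < L s)%N}.
Local Notation T := (T H).
Local Notation Tinv := (Tinv H).
Local Notation c := (c H).
Local Notation dag := (dagger H).
Local Notation bar := (bar H).
Local Notation len := (length S).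
Local Notation w0 := (longest W S).
Local Notation trace := (@trace _ W S L H).
Implicit Types h k : H.

Let foldW := fold_eq H coxW L_gt0.
Let W1 : 1%g \in W := coxeter1 coxW.
Let w0W : w0 \in W := longestW coxW.
Let SW s : s \in S -> s \in W := @simple_in _ _ _ coxW s.
Let WM x y : x \in W -> y \in W -> (x * y)%g \in W := @coxeterM _ _ _ coxW x y.
Let WV x : (x^-1%g \in W) = (x \in W) := coxeterV coxW x.
Let w0K x : (w0 * (w0 * x))%g = x := longestK coxW foldW x.
Let w0M x : ((w0 * x)%g \in W) = (x \in W) := longestMW coxW x.
Let w0Mr x : ((x * w0)%g \in W) = (x \in W) := longestMrW coxW x.

(** The sign makes the coordinate on [T_z] equal to [1]; the other coordinates then
    lie in [v^-1 Z[v^-1]], since [T_w0 (bar T_y) = T_(w0 y)]. *)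
Definition dualc z : H := (-1) ^+ len (w0 * z)%g *: (T w0 * dag (c (w0 * z)%g)).

Lemma c_span x : c x = \sum_(y in W) p_coef H y x *: T y.
Proof. exact: (basis_span (T_basis H)). Qed.

Lemma p_diag x : x \in W -> p_coef H x x = 1.
Proof. exact: (c_diag H). Qed.

Lemma p_offdiag x y : x \in W -> y \in W -> y != x -> deg_le (p_coef H y x) (-1).
Proof. exact: (c_offdiag H). Qed.

Lemma dualc_coord z y : z \in W -> y \in W ->
  Tcoord (dualc z) y =
  (-1) ^+ (len (w0 * z)%g + len (w0 * y)%g) * p_coef H (w0 * y)%g (w0 * z)%g.
Proof.
move=> zW yW; rewrite /dualc (coordZ (T_basis H)) // exprD -mulrA; congr (_ * _).
rewrite c_span linear_sum mulr_sumr (coord_sum (T_basis H)) //.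
rewrite (bigD1 (w0 * y)%g) ?w0M //= [X in _ + X]big1 ?addr0 => [|x /andP [xW ne]].
  rewrite linearZ /= dagger_T ?w0M // -!scalerAr T_longestV ?w0M // w0K.
  rewrite !(coordZ (T_basis H)) // (coord_basis (T_basis H)) // eqxx mulr1.
  by rewrite mulrC.
rewrite linearZ /= dagger_T // -!scalerAr T_longestV //.
rewrite !(coordZ (T_basis H)) // (coord_basis (T_basis H)) ?w0M //.
have [e|] := eqVneq y (w0 * x)%g; last by rewrite !mulr0.
by rewrite e w0K eqxx in ne.
Qed.

Lemma dualc_diag z : z \in W -> Tcoord (dualc z) z = 1.
Proof.
move=> zW; rewrite dualc_coord // p_diag ?w0M // mulr1.
by rewrite addnn -signr_odd odd_double.
Qed.

Lemma dualc_offdiag z y : z \in W -> y \in W -> y != z ->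
  deg_le (Tcoord (dualc z) y) (-1).
Proof.
move=> zW yW ne; rewrite dualc_coord // deg_le_sign // p_offdiag ?w0M //.
by apply: contra_neq ne; apply: mulgI.
Qed.

Lemma bar_dual_pairing x z : x \in W ->
  z \in W -> lbar (trace (c x * dualc z)) = trace (c x * dualc z).
Proof.
move=> xW zW; rewrite /dualc -scalerAr traceZ // lbar_sign; congr (_ * _).
rewrite trace_mulC // -mulrA -coord_longest // -bar_coord_longest // rmorphM.
by rewrite bar_dagger // !c_bar ?w0M.
Qed.

(** The family [dualc] is, up to inversion of the index, dual to the basis [c]
    for the trace form: the pairing lies in [delta + v^-1 Z[v^-1]] since both
    families are unitriangular over the basis [T], and it is invariant
    under the bar involution because it is a [T_w0]-coordinate. *)
Lemma dual_pairing x y : x \in W -> y \in W ->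
  trace (c x * dualc y^-1%g) = (x == y)%:R.
Proof.
move=> xW yW; apply/eqP; rewrite -subr_eq0; apply/eqP; apply: lbar_eq0_neg.
  have -> : lbar (trace (c x * dualc y^-1%g) - (x == y)%:R) =
    lbar (trace (c x * dualc y^-1%g)) - lbar ((x == y)%:R).
    by apply: lcoefP => n; rewrite !(lcoef_lbar, lcoefD, lcoefN).
  rewrite bar_dual_pairing ?WV //; congr (_ - _); case: eqP => _ //; first exact: lbar1.
  by apply: lcoefP => n; rewrite lcoef_lbar !lcoef0.
have d0 z : z \in W -> z != x ->
    deg_le (Tcoord (c x) z * Tcoord (dualc y^-1%g) z^-1%g) (-1).
  move=> zW zx; have [zy | zy] := eqVneq z y.
    by rewrite zy dualc_diag ?WV // mulr1 -zy; exact: (c_offdiag H).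
  apply: (@deg_leW _ (-1 + -1)) => //; apply: deg_leM; first exact: (c_offdiag H).
  by apply: dualc_offdiag; rewrite ?WV // (inj_eq invg_inj).
rewrite trace_mul // (bigD1 x) //= (c_diag H) // mul1r.
have [e | ne] := eqVneq x y.
  subst y; rewrite dualc_diag ?WV // addrAC subrr add0r; apply: deg_le_sum => z /andP [zW zx].
  by apply: d0.
rewrite subr0; apply: deg_leD.
  by apply: dualc_offdiag; rewrite ?WV // (inj_eq invg_inj).
by apply: deg_le_sum => z /andP [zW zx]; apply: d0.
Qed.

Lemma ccoord_trace h z : z \in W -> ccoord h z = trace (h * dualc z^-1%g).
Proof.
move=> zW; rewrite {2}[h](basis_span (c_basis H)) mulr_suml trace_sum //.
rewrite (bigD1 z) //= -scalerAl traceZ // dual_pairing // eqxx mulr1.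
rewrite big1 ?addr0 // => x /andP [xW /negPf ne].
by rewrite -scalerAl traceZ // dual_pairing // ne mulr0.
Qed.

Lemma bar_ccoord h z : z \in W -> ccoord (bar h) z = lbar (ccoord h z).
Proof.
move=> zW; rewrite {1}[h](basis_span (c_basis H)) rmorph_sum (coord_sum (c_basis H)) //.
rewrite (bigD1 z) //= bar_scale c_bar // (coordZ (c_basis H)) //.
rewrite (coord_basis (c_basis H)) // eqxx mulr1 big1 ?addr0 // => x /andP [xW /negPf ne].
rewrite bar_scale c_bar // (coordZ (c_basis H)) // (coord_basis (c_basis H)) // eq_sym.
by rewrite ne mulr0.
Qed.

(** The coordinates of [h] in the basis [c] are fixed by [v |-> v^-1], and they are pairings
    with the unitriangular family [dualc], hence of negative degree. *)
Lemma bar_fixed_eq0 h : bar h = h ->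
  {in W, forall x, deg_le (Tcoord h x) (-1)} -> h = 0.
Proof.
move=> hb hd; apply: (coord_inj (c_basis H)) => z zW.
rewrite (coord0 (c_basis H)) //; apply: lbar_eq0_neg; first by rewrite -bar_ccoord ?hb.
rewrite ccoord_trace // trace_mul //; apply: deg_le_sum => x xW.
rewrite -[-1]addr0; apply: deg_leM; first exact: hd.
have [-> | ne] := eqVneq x z; first by rewrite dualc_diag ?WV // deg_le1.
apply: (@deg_leW _ (-1)) => //.
by apply: dualc_offdiag; rewrite ?WV // (inj_eq invg_inj).
Qed.

Lemma c_unique h x : x \in W -> bar h = h -> Tcoord h x = 1 ->
  {in W, forall y, y != x -> deg_le (Tcoord h y) (-1)} -> h = c x.
Proof.
move=> xW hb h1 hd; apply/eqP; rewrite -subr_eq0; apply/eqP; apply: bar_fixed_eq0.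
  by rewrite rmorphB hb c_bar.
move=> y yW; rewrite (coordD (T_basis H)) // (coordN (T_basis H)) //.
have [-> | ne] := eqVneq y x; first by rewrite h1 (c_diag H) // subrr deg_le0.
apply: deg_leD; first exact: hd.
apply/deg_leP => k k1; rewrite lcoefN.
by have /deg_leP -> := @c_offdiag _ _ _ _ H x y xW yW ne; rewrite ?oppr0.
Qed.

(** This map reverses products and sends [c_x] to [c_(x^-1)], so that it exchanges
    left and right multiplication, and with them the left and right preorders. *)
Definition flat h : H := \sum_(x in W) Tcoord h x *: T x^-1%g.

Lemma flatD h k : flat (h + k) = flat h + flat k.
Proof.
rewrite /flat -big_split /=; apply: eq_bigr => x xW.
by rewrite (coordD (T_basis H)) // scalerDl.
Qed.

Lemma flatZ a h : flat (a *: h) = a *: flat h.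
Proof.
rewrite /flat scaler_sumr; apply: eq_bigr => x xW.
by rewrite (coordZ (T_basis H)) // scalerA.
Qed.

Lemma flat0 : flat 0 = 0.
Proof. by rewrite -(scale0r (0 : H)) flatZ !scale0r. Qed.

Lemma flat_sum I (r : seq I) (P : pred I) (F : I -> H) :
  flat (\sum_(i <- r | P i) F i) = \sum_(i <- r | P i) flat (F i).
Proof. by elim/big_rec2: _ => [|i x y _ <-]; rewrite ?flat0 ?flatD. Qed.

Lemma flat_T x : x \in W -> flat (T x) = T x^-1%g.
Proof.
move=> xW; rewrite /flat (bigD1 x) //= (coord_basis (T_basis H)) // eqxx scale1r.
rewrite big1 ?addr0 // => y /andP [yW /negPf ne].
by rewrite (coord_basis (T_basis H)) // ne scale0r.
Qed.

Lemma Tcoord_flat h x : x \in W -> Tcoord (flat h) x = Tcoord h x^-1%g.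
Proof.
move=> xW; rewrite /flat (reindex_inj invg_inj) /= (eq_bigl (mem W)) => [|y]; last first.
  by rewrite WV.
under eq_bigr => y _ do rewrite invgK.
by rewrite (basis_coord (T_basis H) (fun x => Tcoord h x^-1%g)).
Qed.

(** On [T_s T_y] this compares the left and the right multiplication rules; the
    general case follows by induction on the length. *)
Lemma flatM h k : flat (h * k) = flat k * flat h.
Proof.
have simple s y : s \in S -> y \in W -> flat (T s * T y) = T y^-1%g * T s.
  move=> sS yW; have syW := WM (SW sS) yW; have yVW : y^-1%g \in W by rewrite WV.
  have e : (y^-1 * s)%g = (s * y)^-1%g by rewrite invMg (simpleV coxW sS).
  case: (length_mul_simple coxW sS yW) => l.
    rewrite (T_up H coxW sS yW l) flat_T // -e (T_upr H coxW sS yVW) //.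
    by rewrite e !(lengthV coxW).
  rewrite (T_down H coxW sS yW l) flatD flatZ !flat_T // -e (T_downr H coxW sS yVW) //.
  by rewrite e !(lengthV coxW).
have simpleM s k' : s \in S -> flat (T s * k') = flat k' * T s.
  move=> sS; rewrite {1}[k'](basis_span (T_basis H)) mulr_sumr flat_sum mulr_suml.
  by apply: eq_bigr => y yW; rewrite -scalerAr flatZ simple // scalerAl.
have basisM x k' : x \in W -> flat (T x * k') = flat k' * T x^-1%g.
  move xn: (len x) => n xW; elim: n x xn xW k' => [|n IH] x xn xW k'.
    by rewrite (length_eq0 coxW xW xn) invg1 (T1 H coxW) mulr1 mul1r.
  have [s [u [sS uW e un]]] := length_split coxW xW xn.
  have l : len (s * u)%g = (len u).+1 by rewrite -e xn un.
  have uVW : u^-1%g \in W by rewrite WV.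
  rewrite e -(T_up H coxW sS uW l) -mulrA simpleM // (IH u un uW) -mulrA.
  rewrite invMg (simpleV coxW sS) (T_upr H coxW sS uVW) //.
  have -> : (u^-1 * s)%g = (s * u)^-1%g by rewrite invMg (simpleV coxW sS).
  by rewrite !(lengthV coxW) ?l // WM // SW.
rewrite {1}[h](basis_span (T_basis H)) mulr_suml flat_sum mulr_sumr.
by apply: eq_bigr => x xW; rewrite -scalerAl flatZ basisM // scalerAr.
Qed.

Lemma flat1 : flat 1 = 1.
Proof. by rewrite -(T1 H coxW) flat_T // invg1. Qed.

Lemma flat_Tinv x : x \in W -> flat (Tinv x) = Tinv x^-1%g.
Proof.
move=> xW; rewrite -[LHS]mulr1 -(T_mulV H (_ : x^-1%g \in W)) ?WV // -flat_T //.
by rewrite mulrA -flatM (T_mulV H xW) flat1 mul1r.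
Qed.

Lemma flat_bar h : bar (flat h) = flat (bar h).
Proof.
rewrite [bar h]bar_span flat_sum [flat h]/flat rmorph_sum; apply: eq_bigr => x xW.
by rewrite bar_scale bar_T ?WV // flatZ flat_Tinv ?WV.
Qed.

Lemma flat_c x : x \in W -> flat (c x) = c x^-1%g.
Proof.
move=> xW; apply: c_unique; rewrite ?WV //.
- by rewrite flat_bar c_bar.
- by rewrite Tcoord_flat ?WV // invgK (c_diag H).
move=> y yW ne; rewrite Tcoord_flat //; apply: (c_offdiag H); rewrite ?WV //.
by apply: contra_neq ne => <-; rewrite invgK.
Qed.

Lemma ccoord_flat h x : x \in W -> ccoord (flat h) x = ccoord h x^-1%g.
Proof.
move=> xW; rewrite [h in flat h](basis_span (c_basis H)) flat_sum.
rewrite (coord_sum (c_basis H)) // (bigD1 x^-1%g) ?WV //= flatZ flat_c ?WV // invgK.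
rewrite (coordZ (c_basis H)) // (coord_basis (c_basis H)) // eqxx mulr1 big1 ?addr0 //.
move=> y /andP [yW ne]; rewrite flatZ flat_c // (coordZ (c_basis H)) //.
rewrite (coord_basis (c_basis H)) ?WV //; have [e|] := eqVneq x y^-1%g.
  by rewrite e invgK eqxx in ne.
by rewrite mulr0.
Qed.

Lemma h_coef_flat x y z : x \in W -> y \in W -> z \in W ->
  h_coef H x y z = h_coef H y^-1%g x^-1%g z^-1%g.
Proof.
move=> xW yW zW; rewrite /h_coef -!flat_c // -flatM ccoord_flat ?WV // invgK //.
Qed.

Lemma p_coef_inv x y : x \in W -> y \in W -> p_coef H y^-1%g x^-1%g = p_coef H y x.
Proof. by move=> xW yW; rewrite /p_coef -flat_c // Tcoord_flat ?WV // invgK. Qed.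

Local Notation sigma x := (w0 * x * w0)%g.

Lemma sigmaW x : (sigma x \in W) = (x \in W).
Proof. by rewrite w0Mr w0M. Qed.

Lemma sigmaK x : sigma (sigma x) = x.
Proof. by rewrite -!mulgA w0K (longest_sq coxW foldW) mulg1. Qed.

Lemma sigma_eq x y : (sigma x == sigma y) = (x == y).
Proof. by apply/eqP/eqP => [e | -> //]; rewrite -[x]sigmaK e sigmaK. Qed.

Lemma sigmaV x : sigma x^-1%g = (sigma x)^-1%g.
Proof. by rewrite !invMg (longestV coxW foldW) mulgA. Qed.

Lemma T_longestC x : x \in W -> T w0 * T x = T (sigma x) * T w0.
Proof.
move=> xW; have xVW : x^-1%g \in W by rewrite WV.
have e1 : T (w0 * x^-1)%g * T x = T w0.
  rewrite (T_mul H) ?mulgKV // ?w0M //.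
  by rewrite -(length_longestM coxW foldW xVW) (lengthV coxW).
have e2 : T (sigma x) * T (w0 * x^-1)%g = T w0.
  have e : (sigma x * (w0 * x^-1))%g = w0.
    by rewrite -mulgA w0K mulgK.
  rewrite (T_mul H) ?e // ?sigmaW // ?w0M // (length_conj_longest coxW foldW) //.
  by rewrite -(length_longestM coxW foldW xVW) (lengthV coxW) // addnC.
by rewrite -{1}e2 -mulrA e1.
Qed.

(** Let [k] be obtained from [c_u] by applying [sigma] to the indices of the [T_y].
    Then [T_w0 c_u = k T_w0] and [T_w0 k = c_u T_w0]; applying the bar involution to the
    second identity and comparing with the first shows that [k] is bar-fixed, so
    it is [c_(sigma u)]. *)
Lemma T_longest_c u : u \in W -> T w0 * c u = c (sigma u) * T w0.
Proof.
move=> uW; pose k := \sum_(y in W) p_coef H (sigma y) u *: T y.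
have e1 : T w0 * c u = k * T w0.
  rewrite c_span mulr_sumr mulr_suml (reindex_inj (h := fun y => sigma y)) /=; last first.
    exact: (inv_inj sigmaK).
  rewrite (eq_bigl (mem W)) => [|y]; last by rewrite sigmaW.
  apply: eq_bigr => y yW; rewrite -scalerAr T_longestC ?sigmaW // sigmaK.
  by rewrite scalerAl.
have e2 : T w0 * k = c u * T w0.
  rewrite c_span mulr_sumr mulr_suml [RHS](reindex_inj (h := fun y => sigma y)) /=; last first.
    exact: (inv_inj sigmaK).
  rewrite [RHS](eq_bigl (mem W)) => [|y]; last by rewrite sigmaW.
  by apply: eq_bigr => y yW; rewrite -scalerAr T_longestC // scalerAl.
rewrite e1; congr (_ * _); apply: c_unique; rewrite ?sigmaW //.
- have := congr1 (fun h => T w0 * bar h * T w0) e2.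
  rewrite !rmorphM bar_T // (longestV coxW foldW) (c_bar H) //.
  rewrite !mulrA (T_mulV H) // mul1r -!mulrA (T_mulVl H) // mulr1 e1.
  move=> /(congr1 (fun h => h * Tinv w0)).
  by rewrite -!mulrA (T_mulV H) // !mulr1.
- by rewrite /k (basis_coord (T_basis H) (fun y => p_coef H (sigma y) u)) ?sigmaW // sigmaK p_diag.
move=> y yW ne; rewrite /k (basis_coord (T_basis H) (fun y => p_coef H (sigma y) u)) //.
apply: p_offdiag; rewrite ?sigmaW //.
by apply: contra_neq ne => <-; rewrite sigmaK.
Qed.

End HeckeDuality.

(** * The preorders and the action of the longest element *)

Section Preorders.
Variables (gT : finGroupType) (W S : {set gT}) (L : gT -> nat).
Variable H : hecke W S L.
Hypothesis coxW : coxeter_system W S.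
Hypothesis L_gt0 : {in S, forall s, (0 < L s)%N}.
Local Notation T := (T H).
Local Notation Tinv := (Tinv H).
Local Notation c := (c H).
Local Notation dag := (dagger H).
Local Notation bar := (bar H).
Local Notation len := (length S).
Local Notation w0 := (longest W S).
Local Notation trace := (@trace _ W S L H).
Local Notation sigma x := (w0 * x * w0)%g.
Implicit Types h k : H.

Let foldW := fold_eq H coxW L_gt0.
Let W1 : 1%g \in W := coxeter1 coxW.
Let w0W : w0 \in W := longestW coxW.
Let w0V : (w0^-1)%g = w0 := longestV coxW foldW.
Let SW s : s \in S -> s \in W := @simple_in _ _ _ coxW s.
Let WV x : (x^-1%g \in W) = (x \in W) := coxeterV coxW x.
Let w0K x : (w0 * (w0 * x))%g = x := longestK coxW foldW x.
Let w0M x : ((w0 * x)%g \in W) = (x \in W) := longestMW coxW x.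
Let w0Mr x : ((x * w0)%g \in W) = (x \in W) := longestMrW coxW x.

Lemma Tinv_simple s : s \in S -> Tinv s = T s - (xi L s)%:A.
Proof.
move=> sS; have sW := SW sS.
have e : T s * (T s - (xi L s)%:A) = 1.
  by rewrite mulrBr (T_sq H sS) -scalerAr mulr1 addrK.
by rewrite -[LHS]mulr1 -{1}e mulrA (T_mulVl H sW) mul1r.
Qed.

Lemma c_simple s : s \in S -> c s = T s + (vpow (- (L s)%:Z))%:A.
Proof.
move=> sS; have sW := SW sS; symmetry.
have ne1 : s != 1%g.
  by apply/eqP => e; have := length_simple coxW sS; rewrite e (length1 S).
apply: (c_unique coxW L_gt0) => // [||y yW ne].
- rewrite rmorphD bar_T // bar_scale lbar_mono opprK rmorph1 (simpleV coxW sS) Tinv_simple //.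
  by rewrite /xi scalerBl opprB addrA addrNK.
- rewrite -(T1 H coxW) (coordD (T_basis H)) // (coordZ (T_basis H)) //.
  by rewrite !(coord_basis (T_basis H)) // eqxx (negPf ne1) mulr0 addr0.
rewrite -(T1 H coxW) (coordD (T_basis H)) // (coordZ (T_basis H)) //.
rewrite !(coord_basis (T_basis H)) // (negPf ne) add0r.
case: eqP => _; last by rewrite mulr0 deg_le0.
rewrite mulr1; apply/deg_leP => k k1; rewrite lcoef_mono.
by case: eqP => // e; have := L_gt0 sS; lia.
Qed.

Lemma ccoordM h k z : z \in W ->
  ccoord (h * k) z = \sum_(y in W) ccoord k y * ccoord (h * c y) z.
Proof.
move=> zW; rewrite {1}[k](basis_span (c_basis H)) mulr_sumr (coord_sum (c_basis H)) //.
by apply: eq_bigr => y yW; rewrite -scalerAr (coordZ (c_basis H)).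
Qed.

Lemma sum_neq0 (I : finType) (P : pred I) (F : I -> laurent int) :
  \sum_(i | P i) F i != 0 -> exists2 i, P i & F i != 0.
Proof.
move=> ne; apply/exists_inP; apply: contraNT ne => /exists_inPn e.
by rewrite big1 // => i Pi; apply/eqP; rewrite -[_ == _]negbK e.
Qed.

(** The [c_s] generate the Hecke algebra, so the left preorder also controls the
    multiplication by an arbitrary element. *)
Lemma le_L_mul h x z : x \in W -> z \in W -> ccoord (h * c x) z != 0 -> le_L H z x.
Proof.
pose P k := forall x z, x \in W -> z \in W -> ccoord (k * c x) z != 0 -> le_L H z x.
have PD k k' : P k -> P k' -> P (k + k').
  move=> Pk Pk' y t yW tW; rewrite mulrDl (coordD (c_basis H)) //.
  have [-> | ne _] := eqVneq (ccoord (k * c y) t) 0; last exact: Pk.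
  by rewrite add0r; apply: Pk'.
have PZ b k : P k -> P (b *: k).
  move=> Pk y t yW tW; rewrite -scalerAl (coordZ (c_basis H)) //.
  by move=> /mulr_neq0_laurent [_]; apply: Pk.
have P1 : P 1.
  move=> y t yW tW; rewrite mul1r (coord_basis (c_basis H)) //.
  by have [-> _ | _] := eqVneq t y; [exact: connect0 | rewrite eqxx].
have PM k k' : P k -> P k' -> P (k * k').
  move=> Pk Pk' y t yW tW; rewrite -mulrA ccoordM // => /sum_neq0 [u uW].
  move=> /mulr_neq0_laurent [n1 n2].
  by apply: (connect_trans (Pk _ _ uW tW n2)); apply: Pk'.
have PT s : s \in S -> P (T s).
  move=> sS; have -> : T s = c s + (- vpow (- (L s)%:Z)) *: 1.
    by rewrite c_simple // scaleNr addrK.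
  apply: PD; last exact: PZ; move=> y t yW tW ne; apply: connect1.
  by rewrite /le_L_gen tW yW; apply/exists_inP; exists s.
suff Ph k : P k by apply: Ph.
rewrite [k](basis_span (T_basis H)).
elim/big_ind: _ => [|a b|w wW]; [|exact: PD|apply: PZ].
  by rewrite -(scale0r (1 : H)); apply: PZ.
move wn: (len w) => n; elim: n w wn wW => [|n IH] w wn wW.
  by rewrite (length_eq0 coxW wW wn) (T1 H coxW).
have [s [u [sS uW e un]]] := length_split coxW wW wn.
by rewrite e -(T_up H coxW sS uW) -?e ?wn ?un //; apply: PM; [exact: PT | exact: IH].
Qed.

Lemma le_R_mul h x z : x \in W -> z \in W -> ccoord (c x * h) z != 0 -> le_R H z x.
Proof.
move=> xW zW ne; apply: (@le_L_mul (flat h)); rewrite ?WV //.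
by rewrite -(flat_c H coxW L_gt0) // -(flatM coxW) (ccoord_flat coxW L_gt0) ?WV // invgK.
Qed.

(** The [c_z]-coordinate of [h c_x] pairs it with [+-T_w0 dagger(c_(w0 z^-1))]. Cyclicity
    of the trace moves [h] next to this factor, where it becomes a right
    multiplication by [dagger h]; the same pairing then reads off a coordinate. *)
Lemma ccoord_dual h x z : x \in W -> z \in W ->
  ccoord (h * c x) z = (-1) ^+ (len (w0 * z^-1)%g + len (w0 * x^-1)%g) *
    ccoord (c (w0 * z^-1)%g * dag h) (w0 * x^-1)%g.
Proof.
move=> xW zW; rewrite (ccoord_trace coxW L_gt0) // /dualc -scalerAr traceZ //.
rewrite exprD -mulrA; congr (_ * _).
rewrite trace_mulC // -!mulrA.
have -> : dag (c (w0 * z^-1)%g) * (h * c x) =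
   dag (c (w0 * z^-1)%g * dag h) * c x.
  by rewrite mulrA rmorphM /= (daggerK coxW).
set k := c _ * dag h.
rewrite {1}[k](basis_span (c_basis H)) linear_sum mulr_suml mulr_sumr trace_sum //.
have pair y : y \in W -> trace (T w0 * (dag (c y) * c x)) =
    (-1) ^+ len y * (x == y^-1 * w0)%g%:R.
  move=> yW; rewrite mulrA trace_mulC //.
  have yw : (y^-1 * w0)%g \in W by rewrite w0Mr WV.
  rewrite -(dual_pairing H coxW L_gt0 xW yw) /dualc.
  have -> : (w0 * (y^-1 * w0)^-1)%g = y by rewrite invMg invgK w0V w0K.
  by rewrite -scalerAr traceZ // [RHS]mulrA -expr2 sqrr_sign mul1r.
rewrite (bigD1 (w0 * x^-1)%g) ?w0M ?WV //= linearZ /= -scalerAl -scalerAr traceZ //.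
rewrite pair ?w0M ?WV // invMg !invgK -mulgA w0V (longest_sq coxW foldW) mulg1 eqxx mulr1.
rewrite mulrC big1 ?addr0 // => y /andP [yW ne].
rewrite linearZ /= -scalerAl -scalerAr traceZ // pair //.
case: eqP => [e|]; last by rewrite !mulr0.
by case/eqP: ne; rewrite e invMg invgK w0V w0K.
Qed.

(** By adjunction, a nonzero coordinate of [c_s c_x] on [c_z] yields one of
    [c_(w0 z^-1) (dagger c_s)] on [c_(w0 x^-1)]; the inverses of these indices are
    [z w0] and [x w0], and [le_R_mul] applies. *)
Lemma le_L_longest z x : le_L H z x -> le_L H (x * w0)%g (z * w0)%g.
Proof.
have inv y : ((w0 * y^-1)^-1 = y * w0)%g by rewrite invMg invgK w0V.
have step z' x' : le_L_gen H z' x' -> le_L H (x' * w0)%g (z' * w0)%g.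
  case/and3P => zW xW /exists_inP [s sS]; rewrite /h_coef ccoord_dual //.
  rewrite sign_mul_eq0 => /le_R_mul; rewrite !w0M !WV /le_R !inv; exact.
move=> /connectP [p]; elim: p z => [|y p IH] z /=; first by move=> _ ->; exact: connect0.
move=> /andP [/step zy pth] ex; apply: connect_trans zy; exact: IH.
Qed.

Lemma le_R_longest z x : le_R H z x -> le_R H (w0 * x)%g (w0 * z)%g.
Proof.
by move=> zx; rewrite /le_R !invMg w0V; apply: le_L_longest.
Qed.

Lemma le_LR_L x y : le_L H x y -> le_LR H x y.
Proof. by move=> xy; apply: connect1; rewrite xy. Qed.

Lemma le_LR_R x y : le_R H x y -> le_LR H x y.
Proof. by move=> xy; apply: connect1; rewrite xy orbT. Qed.

Lemma ccoord_conj_longest h z : z \in W ->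
  ccoord (T w0 * h * Tinv w0) (sigma z) = ccoord h z.
Proof.
move=> zW; have szW : sigma z \in W by rewrite sigmaW.
have cK x : x \in W -> T w0 * c x * Tinv w0 = c (sigma x).
  by move=> xW; rewrite (T_longest_c H coxW L_gt0) // -mulrA (T_mulV H) // mulr1.
rewrite {1}[h](basis_span (c_basis H)) mulr_sumr mulr_suml (coord_sum (c_basis H)) //.
rewrite (bigD1 z) //= -scalerAr -scalerAl cK // (coordZ (c_basis H)) //.
rewrite (coord_basis (c_basis H)) // eqxx mulr1 big1 ?addr0 // => x /andP [xW ne].
rewrite -scalerAr -scalerAl cK // (coordZ (c_basis H)) //.
rewrite (coord_basis (c_basis H)) ?sigmaW //.
by rewrite (sigma_eq H coxW L_gt0) eq_sym (negPf ne) mulr0.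
Qed.

Lemma p_coef_sigma x y : x \in W -> y \in W ->
  p_coef H (sigma y) (sigma x) = p_coef H y x.
Proof.
move=> xW yW.
have -> : p_coef H y x = Tcoord (T w0 * c x * Tinv w0) (sigma y).
  have cK z : z \in W -> T w0 * T z * Tinv w0 = T (sigma z).
    by move=> zW; rewrite (T_longestC H coxW L_gt0) // -mulrA (T_mulV H) // mulr1.
  rewrite c_span mulr_sumr mulr_suml (coord_sum (T_basis H)) ?sigmaW //.
  rewrite (bigD1 y) //= -scalerAr -scalerAl cK // (coordZ (T_basis H)) ?sigmaW //.
  rewrite (coord_basis (T_basis H)) ?sigmaW // eqxx mulr1 big1 ?addr0 // => z /andP [zW ne].
  rewrite -scalerAr -scalerAl cK // (coordZ (T_basis H)) ?sigmaW //.
  rewrite (coord_basis (T_basis H)) ?sigmaW //.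
  by rewrite (sigma_eq H coxW L_gt0) eq_sym (negPf ne) mulr0.
by rewrite (T_longest_c H coxW L_gt0) // -mulrA (T_mulV H) // mulr1.
Qed.

Lemma sign_length_inv y : y \in W -> len (w0 * y^-1)%g = len (w0 * y)%g.
Proof.
move=> yW; apply: (@addIn (len y)).
by rewrite (length_longestM coxW foldW yW) -(lengthV coxW yW) (length_longestM coxW foldW) ?WV.
Qed.

Lemma p_coef1_inv y : y \in W -> p_coef H 1%g (w0 * y^-1)%g = p_coef H 1%g (w0 * y)%g.
Proof.
move=> yW; rewrite -p_coef_sigma ?w0M ?WV // mulg1 (longest_sq coxW foldW) w0K.
rewrite -[RHS](p_coef_inv H coxW L_gt0) ?w0M // invMg w0V invg1 //.
Qed.

(** The case of [T_w0] in the inversion of the matrix [p_(y, x)]: the coordinate is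
    the one of [dualc] on [T_w0]. *)
Lemma ccoord_T_longest y : y \in W ->
  ccoord (T w0) y = (-1) ^+ len (w0 * y)%g * p_coef H 1%g (w0 * y)%g.
Proof.
move=> yW; rewrite (ccoord_trace coxW L_gt0) // -(coord_longest coxW L_gt0).
rewrite (dualc_coord H coxW L_gt0) ?WV // (longest_sq coxW foldW) (length1 S) addn0.
by rewrite sign_length_inv // p_coef1_inv.
Qed.

Lemma ccoord_longest_c u z : u \in W -> z \in W ->
  ccoord (T w0 * c u) z = \sum_(y in W)
    ((-1) ^+ len (w0 * y)%g * p_coef H 1%g (w0 * y)%g) * h_coef H y u z.
Proof.
move=> uW zW; rewrite {1}[T w0](basis_span (c_basis H)) mulr_suml.
rewrite (coord_sum (c_basis H)) //; apply: eq_bigr => y yW.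
by rewrite -scalerAl (coordZ (c_basis H)) // ccoord_T_longest.
Qed.

(** The adjoint relation, in which [dagger T_w0 = +-bar T_w0]; the anti-automorphism and
    conjugation by [T_w0] bring the right multiplication back to the left. *)
Lemma ccoord_longest_dual u z : u \in W -> z \in W -> exists n,
  ccoord (T w0 * c u) z = (-1) ^+ n * lbar (ccoord (T w0 * c (w0 * z)%g) (w0 * u)%g).
Proof.
move=> uW zW; rewrite ccoord_dual // dagger_T // w0V -scalerAr.
rewrite (coordZ (c_basis H)) ?w0M ?WV // mulrA -exprD; set n := (_ + _)%N; exists n.
congr (_ * _).
have -> : Tinv w0 = bar (T w0) by rewrite bar_T // w0V.
rewrite -{1}(c_bar H (x := (w0 * z^-1)%g)) ?w0M ?WV // -rmorphM.
rewrite bar_ccoord ?w0M ?WV //; congr lbar.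
rewrite -[(w0 * u^-1)%g]invgK -(ccoord_flat coxW L_gt0) ?WV ?w0M ?WV //.
rewrite (flatM coxW) (flat_T H) // (flat_c H coxW L_gt0) ?w0M ?WV //.
rewrite !invMg !invgK w0V.
have e x : (x * w0 = sigma (w0 * x))%g by rewrite w0K.
rewrite (e z) (e u) -[RHS]ccoord_conj_longest ?w0M //; congr (ccoord _ _).
by rewrite -mulrA [_ * Tinv w0](_ : _ = c (sigma (w0 * z))) // (T_longest_c H coxW L_gt0) ?w0M // -mulrA (T_mulV H) // mulr1.
Qed.

End Preorders.

(** * The matrix of the longest element on a cell *)

Lemma sum_sqr_eq1 (I : finType) (P : pred I) (f : I -> int) :
  \sum_(i | P i) f i * f i = 1 ->
  exists2 i, P i & (f i = 1 \/ f i = -1) /\ forall j, P j -> j != i -> f j = 0.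
Proof.
move=> sum1; have [i Pi fi0] : exists2 i, P i & f i != 0.
  apply/exists_inP; apply: contra_eqT sum1 => /exists_inPn e.
  by rewrite big1 // => i /e; rewrite negbK => /eqP->; rewrite mul0r.
have sq k : 0 <= f k * f k by rewrite -expr2 sqr_ge0.
move: sum1; rewrite (bigD1 i) //= => sum1.
have r0 : 0 <= \sum_(j | P j && (j != i)) f j * f j by apply: sumr_ge0.
have f1 : f i * f i = 1.
  have : f i * f i != 0 by rewrite mulf_neq0.
  by move: (sq i) r0 sum1; move: (f i * f i) (\sum_(j | _) _) => p q; lia.
exists i => //; split.
  by move/eqP: f1; rewrite -expr2 sqrf_eq1 => /orP [] /eqP; [left | right].
move=> j Pj ji; have r1 : \sum_(j | P j && (j != i)) f j * f j = 0.
  by apply: (@addrI _ 1); rewrite -{1}f1 sum1 addr0.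
have Pij : P j && (j != i) by rewrite Pj ji.
have /eqP := psumr_eq0P (fun j _ => sq j) r1 Pij.
by rewrite mulf_eq0 orbb => /eqP.
Qed.

Section CellMatrix.
Variables (gT : finGroupType) (W S : {set gT}) (L : gT -> nat).
Variable H : hecke W S L.
Hypothesis coxW : coxeter_system W S.
Hypothesis L_gt0 : {in S, forall s, (0 < L s)%N}.
Hypothesis P_H : P1_to_P15 H.
Local Notation T := (T H).
Local Notation Tinv := (Tinv H).
Local Notation c := (c H).
Local Notation dag := (dagger H).
Local Notation bar := (bar H).
Local Notation len := (length S).
Local Notation w0 := (longest W S).
Local Notation sigma x := (w0 * x * w0)%g.
Implicit Types h k : H.

Let foldW := fold_eq H coxW L_gt0.
Let W1 : 1%g \in W := coxeter1 coxW.
Let w0W : w0 \in W := longestW coxW.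
Let w0V : (w0^-1)%g = w0 := longestV coxW foldW.
Let WV x : (x^-1%g \in W) = (x \in W) := coxeterV coxW x.
Let w0K x : (w0 * (w0 * x))%g = x := longestK coxW foldW x.
Let w0M x : ((w0 * x)%g \in W) = (x \in W) := longestMW coxW x.

Lemma h_coef_deg x y z : x \in W -> y \in W -> deg_le (h_coef H x y z) (a_fun H z)%:Z.
Proof.
move=> xW yW; rewrite /a_fun; case: ex_minnP => n + _.
by move=> /forall_inP /(_ x xW) /forall_inP /(_ y yW).
Qed.

Lemma p_coef1_deg x : x \in W -> deg_le (p_coef H 1%g x) (- (a_fun H x)%:Z).
Proof.
move=> xW; have [-> | /ldegP [_]] := eqVneq (p_coef H 1%g x) 0; first exact: deg_le0.
by apply: deg_leW; have := P1 P_H xW; rewrite /Delta lerNr.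
Qed.

Lemma a_fun_longest_le y u z : y \in W -> u \in W -> z \in W ->
  h_coef H y u z != 0 -> (a_fun H (w0 * z) <= a_fun H (w0 * y))%N.
Proof.
move=> yW uW zW ne; apply: (P4 P_H); rewrite ?w0M //; apply: le_LR_R.
by apply: (le_R_longest coxW L_gt0) => //; apply: (le_R_mul coxW L_gt0) ne.
Qed.

(** If [c_z] occurs in [c_y c_u] then [a (w0 y) >= a (w0 z)]; hence each term of the
    expansion of [T_w0 c_u] has degree at most [a z - Delta (w0 y) <= a z - a (w0 z)]. *)
Lemma longest_coef_deg u z : u \in W -> z \in W ->
  deg_le (ccoord (T w0 * c u) z) (- (a_fun H (w0 * z)%g)%:Z + (a_fun H z)%:Z).
Proof.
move=> uW zW; rewrite (ccoord_longest_c H coxW L_gt0) //.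
apply: deg_le_sum => y yW.
have [-> | ne] := eqVneq (h_coef H y u z) 0; first by rewrite mulr0 deg_le0.
apply: deg_leM (h_coef_deg _ _ _) => //; apply: deg_le_sign.
apply: deg_leW (p_coef1_deg _); rewrite ?w0M //.
by rewrite lerN2 lez_nat (a_fun_longest_le yW uW zW).
Qed.

(** In the extreme degree only the top coefficients of the factors contribute. *)
Lemma longest_coef_top u z : u \in W -> z \in W ->
  lcoef (ccoord (T w0 * c u) z) (- (a_fun H (w0 * z)%g)%:Z + (a_fun H z)%:Z) =
  \sum_(y in W) lcoef ((-1) ^+ len (w0 * y)%g * p_coef H 1%g (w0 * y)%g)
                      (- (a_fun H (w0 * z)%g)%:Z)
    * lcoef (h_coef H y u z) (a_fun H z)%:Z.
Proof.
move=> uW zW; rewrite (ccoord_longest_c H coxW L_gt0) // lcoef_sum.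
apply: eq_bigr => y yW.
have [-> | ne] := eqVneq (h_coef H y u z) 0; first by rewrite mulr0 !lcoef0 mulr0.
apply: lcoefM_top (h_coef_deg _ _ _) => //; apply: deg_le_sign.
apply: deg_leW (p_coef1_deg _); rewrite ?w0M //.
by rewrite lerN2 lez_nat (a_fun_longest_le yW uW zW).
Qed.

Lemma le_L_sigma x y : le_L H x y -> le_L H (sigma x) (sigma y).
Proof.
have cK z : z \in W -> T w0 * c z = c (sigma z) * T w0 := @T_longest_c _ _ _ _ H coxW L_gt0 z.
have step z' x' : le_L_gen H z' x' -> le_L H (sigma z') (sigma x').
  case/and3P => zW xW /exists_inP [s sS]; have sW := simple_in coxW sS.
  rewrite /h_coef -(ccoord_conj_longest coxW L_gt0) // mulrA cK // -!mulrA.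
  rewrite (mulrA _ _ (Tinv _)) cK // -!mulrA (T_mulV H) // mulr1.
  by apply: (le_L_mul coxW L_gt0); rewrite sigmaW.
move=> /connectP [p]; elim: p x => [|z p IH] x /=; first by move=> _ ->; exact: connect0.
move=> /andP [/step xz pth] ey; apply: (connect_trans xz); exact: IH.
Qed.

Lemma le_LR_sigma x y : le_LR H x y -> le_LR H (sigma x) (sigma y).
Proof.
move=> /connectP [p]; elim: p x => [|z p IH] x /=; first by move=> _ ->; exact: connect0.
move=> /andP [xz pth] ey; apply: connect_trans (IH _ pth ey).
case/orP: xz => xz; [apply: le_LR_L | apply: le_LR_R]; first exact: le_L_sigma.
by rewrite /le_R -!(sigmaV H coxW L_gt0); apply: le_L_sigma.
Qed.





Section Cell.
Variables (C : {set gT}) (a a' : nat).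
Hypothesis cellC : two_sided_cell H C.
Hypothesis aC : {in C, forall u, a_fun H u = a}.
Hypothesis aw0C : {in (w0 *: C)%g, forall u, a_fun H u = a'}.

Lemma cellW u : u \in C -> u \in W.
Proof. by case: cellC => x _ ->; rewrite inE => /andP []. Qed.

Lemma sim_LR_sym x y : sim_LR H x y = sim_LR H y x.
Proof. by rewrite /sim_LR andbC. Qed.

Lemma sim_LR_trans y x z : sim_LR H x y -> sim_LR H y z -> sim_LR H x z.
Proof.
move=> /andP [xy yx] /andP [yz zy]; apply/andP; split.
  exact: connect_trans xy yz.
exact: connect_trans zy yx.
Qed.

Lemma cell_sim u v : u \in C -> v \in C -> sim_LR H u v.
Proof.
case: cellC => x _ ->; rewrite !inE => /andP [_ xu] /andP [_ xv].
by apply: sim_LR_trans xv; rewrite sim_LR_sym.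
Qed.

Lemma cell_closed u v : u \in C -> v \in W -> sim_LR H u v -> v \in C.
Proof.
case: cellC => x _ ->; rewrite !inE => /andP [_ xu] -> uv.
exact: sim_LR_trans uv.
Qed.

Lemma cellV u : (u^-1%g \in C) = (u \in C).
Proof.
have imp v : v \in C -> v^-1%g \in C.
  by move=> vC; have vW := cellW vC; apply: (cell_closed vC); rewrite ?WV // (P14 P_H).
by apply/idP/idP => /imp //; rewrite invgK.
Qed.

Lemma a_longest u : u \in C -> a_fun H (w0 * u)%g = a'.
Proof. by move=> uC; apply: aw0C; rewrite mem_lcoset mulKg. Qed.

Local Notation below x := [exists x' in C, lt_LR H x x'].

Lemma below_or_cell x u : u \in C -> x \in W -> le_LR H x u -> (x \in C) || below x.
Proof.
move=> uC xW xu; have [ux | ux] := boolP (sim_LR H u x).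
  by rewrite (cell_closed uC xW ux).
by apply/orP; right; apply/exists_inP; exists u => //; rewrite /lt_LR xu sim_LR_sym.
Qed.

Lemma cell_not_below x : x \in C -> ~~ below x.
Proof.
move=> xC; apply/exists_inPn => y yC.
by rewrite negb_and negbK cell_sim ?orbT.
Qed.

Local Notation top := (- a'%:Z + a%:Z).

(** Applying [dagger], which sends [T_w0] to [+-bar T_w0], reduces the action on the
    [dagger c_u] to [T_w0 c_u]. Only the coefficient of [v^(a - a')] is recorded, since
    it is the only one that occurs ([longest_coef_cell]). *)
Definition cell_matrix (z u : gT) : int :=
  (-1) ^+ len w0 * lcoef (ccoord (T w0 * c u) z) top.

(** The upper bound on the degrees holds at [(z, u)] and, after passing to the
    adjoint, at [(w0 u, w0 z)]; there it is a lower bound on those at [(z, u)]. *)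
Lemma longest_coef_cell u z : u \in C -> z \in C ->
  ccoord (T w0 * c u) z = lmono ((-1) ^+ len w0 * cell_matrix z u) top.
Proof.
move=> uC zC; have [uW zW] := (cellW uC, cellW zC).
rewrite /cell_matrix mulrA -expr2 sqrr_sign mul1r.
apply: lcoefP => k; rewrite lcoef_mono.
have [-> | ne] := eqVneq top k; first by rewrite mulr1n.
rewrite mulr0n; move: ne; rewrite neq_lt => /orP [lt | gt].
  have /deg_leP := longest_coef_deg uW zW.
  by rewrite (aC zC) (a_longest zC); apply.
have [n ->] := ccoord_longest_dual H coxW L_gt0 uW zW.
suff e : lcoef (lbar (ccoord (T w0 * c (w0 * z)%g) (w0 * u)%g)) k = 0.
  by rewrite -signr_odd mulr_sign; case: odd; rewrite ?lcoefN e ?oppr0.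
have /deg_leP := longest_coef_deg (etrans (w0M z) zW) (etrans (w0M u) uW).
by rewrite w0K (aC uC) (a_longest uC) lcoef_lbar; apply; lia.
Qed.

(** In terms of [gamma] the summand at [y] of one side is the summand at [y^-1] of
    the other: [gamma(y, u, z^-1) = gamma(u^-1, y^-1, z)] by the anti-automorphism,
    and this is [gamma(y^-1, z, u^-1)] by cyclicity. *)
Lemma cell_matrix_sym u z : u \in C -> z \in C -> cell_matrix z u = cell_matrix u z.
Proof.
move=> uC zC; have [uW zW] := (cellW uC, cellW zC); congr (_ * _).
have := longest_coef_top uW zW; have := longest_coef_top zW uW.
rewrite !(aC uC, aC zC, a_longest uC, a_longest zC) => -> ->.
rewrite [LHS](reindex_inj invg_inj) /=.
rewrite (eq_bigl (mem W)) => [|y]; last by rewrite WV.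
apply: eq_bigr => y yW; rewrite (sign_length_inv H coxW L_gt0) // (p_coef1_inv H coxW L_gt0) //.
congr (_ * _).
have := P7 P_H (etrans (WV u) uW) yW zW.
rewrite /gamma invgK (aC uC) (h_coef_flat H coxW L_gt0) ?WV // !invgK.
by rewrite aC ?cellV // => ->.
Qed.

Lemma longest_coef_below x u : u \in C -> x \in W -> x \notin C -> ~~ below x ->
  forall h, ccoord (h * c u) x = 0.
Proof.
move=> uC xW xC xb h; apply/eqP; apply: contraR xC => ne.
have /le_LR_L xu := le_L_mul coxW L_gt0 (cellW uC) xW ne.
by have := below_or_cell uC xW xu; rewrite (negPf xb) orbF.
Qed.

Lemma bar_longest_c u : u \in W -> Tinv w0 * c u = bar (T w0 * c u).
Proof. by move=> uW; rewrite rmorphM bar_T // w0V (c_bar H). Qed.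

(** Since [bar T_w0] is the inverse of [T_w0], a matrix fixed by the bar
    involution squares to the identity. *)
Lemma cell_matrix_sq u z : u \in C -> z \in C ->
  \sum_(x in C) cell_matrix z x * cell_matrix x u = (z == u)%:R.
Proof.
move=> uC zC; have [uW zW] := (cellW uC, cellW zC).
have := congr1 (fun h => lcoef (ccoord h z) 0) (mulrA (Tinv w0) (T w0) (c u)).
rewrite (T_mulVl H) // mul1r (coord_basis (c_basis H)) // ccoordM // lcoef_sum.
(* A nonzero term has [z <= x <= u] for the left preorder, which puts [x] in [C]. *)
rewrite (bigID (mem C)) /= [X in _ + X]big1 ?addr0 => [|x /andP [xW xC]]; last first.
  have [xb | xb] := boolP (below x); last by rewrite (longest_coef_below uC) // mul0r lcoef0.
  suff -> : ccoord (Tinv w0 * c x) z = 0 by rewrite mulr0 lcoef0.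
  apply/eqP; apply: contraTT xb => ne.
  have /le_LR_L zx := le_L_mul coxW L_gt0 xW zW ne.
  apply/exists_inPn => y yC; rewrite negb_and negbK; apply/orP.
  have [xy|] := boolP (le_LR H x y); last by left.
  right; apply/andP; split=> //; apply: connect_trans zx.
  by have /andP [] := cell_sim yC zC.
move=> e; transitivity (lcoef ((z == u)%:R : laurent int) 0); last first.
  by case: eqP => _; rewrite ?lcoef0 // laurent1 lcoef_mono eqxx.
rewrite -e; rewrite [RHS](eq_bigl (mem C)) => [|x]; last first.
  by rewrite andb_idl // => /cellW.
apply: eq_bigr => x xC; rewrite bar_longest_c ?cellW // bar_ccoord //.
rewrite !longest_coef_cell // lbar_mono.
rewrite lmonoM lcoef_mono subrr eqxx mulr1n.
by rewrite [RHS]mulrACA -expr2 sqrr_sign mul1r mulrC.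
Qed.

(** By symmetry the diagonal entry of the square is the sum of the squares of the
    entries of a column. *)
Lemma cell_matrix_monomial u : u \in C -> exists2 x, x \in C &
  (cell_matrix x u = 1 \/ cell_matrix x u = -1) /\
  {in C, forall y, y != x -> cell_matrix y u = 0}.
Proof.
move=> uC; apply: sum_sqr_eq1; have := cell_matrix_sq uC uC; rewrite eqxx => e.
rewrite -[RHS]e; apply: eq_bigr => x xC; congr (_ * _).
by rewrite cell_matrix_sym.
Qed.

Lemma below_cellP h :
  below_cell C h <-> {in W, forall x, ~~ below x -> ccoord (dag h) x = 0}.
Proof.
split=> [[f ->] x xW xb | h0].
  rewrite linear_sum (coord_sum (c_basis H)) // big1 // => y /andP [yW yb].
  rewrite linearZ /= (daggerK coxW) (coordZ (c_basis H)) // (coord_basis (c_basis H)) //.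
  by have [e | _] := eqVneq x y; [rewrite e yb in xb | rewrite mulr0].
exists (ccoord (dag h)); rewrite -{1}[h](daggerK coxW).
rewrite {1}[dag h](basis_span (c_basis H)) linear_sum.
rewrite (bigID (fun x => below x)) /= [X in _ + X]big1 ?addr0 => [|x /andP [xW xb]].
  by apply: eq_bigr => x _; rewrite linearZ.
by rewrite h0 // scale0r linear0.
Qed.

(** The congruence modulo the lower cells only concerns the coordinates in [C]: every
    [c_x] occurring in [T_w0 c_u] has [x <= u], so [x] is in [C] or below it. *)
Lemma longest_actsP u x0 (e : int) : u \in C -> x0 \in C ->
  below_cell C (vpow (a%:Z - a'%:Z) *: (T w0 * dag (c u)) - e%:~R *: dag (c x0)) <->
  {in C, forall x, cell_matrix x u = e * (x == x0)%:R}.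
Proof.
move=> uC x0C; have [uW x0W] := (cellW uC, cellW x0C).
set h := (X in below_cell C X).
have dagh : dag h =
    vpow (a%:Z - a'%:Z) *: ((-1) ^+ len w0 *: bar (T w0 * c u)) - e%:~R *: c x0.
  have eT : dag (T w0 * dag (c u)) = (-1) ^+ len w0 *: bar (T w0 * c u).
    by rewrite [LHS]rmorphM /= (daggerK coxW) dagger_T // w0V -scalerAl bar_longest_c.
  rewrite /h raddfB /= [dag (_ *: (T w0 * _))]linearZ [dag (_ *: dag _)]linearZ /=.
  by rewrite eT (daggerK coxW).
have coordh x : x \in C ->
    ccoord (dag h) x = (cell_matrix x u - e * (x == x0)%:R)%:~R.
  move=> xC; have xW := cellW xC.
  rewrite dagh (coordD (c_basis H)) // (coordN (c_basis H)) // intrB intrM.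
  rewrite !(coordZ (c_basis H)) // (coord_basis (c_basis H)) // bar_ccoord //.
  rewrite longest_coef_cell // lbar_mono mulrz_nat; congr (_ - _).
  have -> : (-1) ^+ len w0 = lmono ((-1) ^+ len w0) 0 :> laurent int.
    by rewrite lmono_int rmorphXn rmorphN1.
  rewrite !lmonoM mul1r mulrA -expr2 sqrr_sign mul1r -lmono_int; congr lmono; lia.
rewrite below_cellP; split=> [h0 x xC | Y x xW xb].
  apply/eqP; rewrite -subr_eq0; apply/eqP.
  have := congr1 (fun p => lcoef p 0) (h0 x (cellW xC) (cell_not_below xC)).
  by rewrite coordh // -lmono_int lcoef_mono eqxx lcoef0.
have [xC | xC] := boolP (x \in C); first by rewrite coordh // Y // subrr.
rewrite dagh (coordD (c_basis H)) // (coordN (c_basis H)) // !(coordZ (c_basis H)) //.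
rewrite -bar_longest_c // longest_coef_below // (coord_basis (c_basis H)) //.
have -> : (x == x0) = false by apply: contraNF xC => /eqP->.
by rewrite !mulr0 subr0.
Qed.

Lemma cell_matrix_neq0 z u : u \in C -> z \in C -> cell_matrix z u != 0 ->
  ccoord (T w0 * c u) z != 0.
Proof. by move=> uC zC; apply: contra_neq => e; rewrite /cell_matrix e lcoef0 mulr0. Qed.

Lemma longest_c_sigma u : u \in W -> T w0 * c (sigma u) = c u * T w0.
Proof.
by move=> uW; rewrite (T_longest_c H coxW L_gt0) ?sigmaW // (sigmaK H coxW L_gt0).
Qed.

(** Some [c_z] with [z] in the cell occurs in [T_w0 c_u = c_(sigma u) T_w0], hence
    [u <= z <= sigma u]; applying [sigma] gives the opposite comparison. *)
Lemma cell_sigma u : u \in C -> sigma u \in C.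
Proof.
move=> uC; have [uW sW] := (cellW uC, etrans (sigmaW coxW u) (cellW uC)).
have [z zC [Yz _]] := cell_matrix_monomial uC.
have le : le_LR H u (sigma u).
  have /andP [uz _] := cell_sim uC zC; apply: (connect_trans uz).
  apply: le_LR_R; apply: (le_R_mul coxW L_gt0 (h := T w0)) => //; first exact: cellW.
  rewrite -(T_longest_c H coxW L_gt0) //; apply: cell_matrix_neq0 => //.
  by case: Yz => ->.
apply: (cell_closed uC) => //; rewrite /sim_LR le /=.
by have := le_LR_sigma le; rewrite (sigmaK H coxW L_gt0).
Qed.

Lemma cell_matrix_sigma z u : u \in C -> z \in C ->
  cell_matrix (sigma z) (sigma u) = cell_matrix z u.
Proof.
move=> uC zC; have [uW zW] := (cellW uC, cellW zC); congr (_ * lcoef _ _).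
rewrite longest_c_sigma // -[RHS](ccoord_conj_longest coxW L_gt0) //.
rewrite (T_longest_c H coxW L_gt0) // mulrA longest_c_sigma //.
by rewrite -(mulrA _ (T w0) (Tinv w0)) (T_mulV H) // mulr1.
Qed.

(** The anti-automorphism sends [T_w0 c_u] to [c_(u^-1) T_w0 = T_w0 c_(sigma u^-1)]. *)
Lemma cell_matrix_flat z u : u \in C -> z \in C ->
  cell_matrix z^-1%g (sigma u^-1)%g = cell_matrix z u.
Proof.
move=> uC zC; have [uW zW] := (cellW uC, cellW zC); congr (_ * lcoef _ _).
rewrite longest_c_sigma ?WV // -(ccoord_flat coxW L_gt0) // (flatM coxW).
by rewrite (flat_T H) // w0V (flat_c H coxW L_gt0) ?WV // invgK.
Qed.



End Cell.
End CellMatrix.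

(** * The action of the longest element on a cell module *)

Theorem theorem2p3 (gT : finGroupType) (W S : {set gT}) (L : gT -> nat)
    (H : hecke W S L)
    (coxW : coxeter_system W S)
    (weightL : weight_function W S L)
    (L_gt0 : {in S, forall s, (0 < L s)%N})
    (P_H : P1_to_P15 H)
    (C : {set gT}) (cellC : two_sided_cell H C)
    (a a' : nat)
    (aC : {in C, forall u, a_fun H u = a})
    (aw0C : {in (longest W S *: C)%g, forall u, a_fun H u = a'}) :
  let sigma := fun w : gT => (longest W S * w * longest W S)%g in
  (exists! star : {perm gT}, perm_on C star /\
     exists eps : gT -> int, longest_acts H C a a' star eps) /\
  (forall (star : {perm gT}) (eps : gT -> int),
     perm_on C star -> longest_acts H C a a' star eps ->
     {in C, forall u,
       [/\ star (star u) = u,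
           [/\ eps u^-1%g = eps u, eps u = eps (sigma u)
             & eps (sigma u) = eps (star u)]
         & sigma (star u) = star (sigma u)
           /\ star (sigma u) = ((star u^-1)^-1)%g]}).
Proof.
  (* your proof *)
Proof.
move=> sigma; pose Y := cell_matrix H a a'.
have CV u : (u^-1%g \in C) = (u \in C) := @cellV _ _ _ _ _ coxW P_H _ cellC u.
have Csigma u : u \in C -> sigma u \in C.
  exact: (@cell_sigma _ _ _ _ _ coxW L_gt0 P_H _ a a' cellC aC aw0C).
have Ysym u z : u \in C -> z \in C -> Y z u = Y u z.
  exact: (@cell_matrix_sym _ _ _ _ _ coxW L_gt0 P_H _ a a' cellC aC aw0C).
have Ymono u : u \in C -> exists2 x, x \in C &
    (Y x u = 1 \/ Y x u = -1) /\ {in C, forall y, y != x -> Y y u = 0}.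
  exact: (@cell_matrix_monomial _ _ _ _ _ coxW L_gt0 P_H _ a a' cellC aC aw0C).
have Ysigma z u : u \in C -> z \in C -> Y (sigma z) (sigma u) = Y z u.
  exact: (@cell_matrix_sigma _ _ _ _ _ coxW L_gt0 _ a a' cellC).
have Yflat z u : u \in C -> z \in C -> Y z^-1%g (sigma u^-1)%g = Y z u.
  exact: (@cell_matrix_flat _ _ _ _ _ coxW L_gt0 _ a a' cellC).
have actP u x0 (e : int) : u \in C -> x0 \in C ->
    below_cell C (vpow (a%:Z - a'%:Z) *:
      (T H (longest W S) * dagger H (c H u)) - e%:~R *: dagger H (c H x0)) <->
    {in C, forall x, Y x u = e * (x == x0)%:R}.
  exact: (@longest_actsP _ _ _ _ _ coxW L_gt0 P_H _ a a' cellC aC aw0C).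
have actY (star : {perm gT}) eps : perm_on C star -> longest_acts H C a a' star eps ->
    {in C, forall u, [/\ star u \in C, eps u != 0 &
      {in C, forall x, Y x u = eps u * (x == star u)%:R}]}.
  move=> onC acts u uC; have [e1 b] := acts u uC.
  have sC : star u \in C by rewrite (perm_closed _ onC).
  by split=> //; [case: e1 => -> | exact/actP].
have Yuniq (star : {perm gT}) eps : perm_on C star -> longest_acts H C a a' star eps ->
    {in C &, forall u x, Y x u != 0 -> x = star u /\ Y x u = eps u}.
  move=> onC acts u x uC xC; have [_ _ Yu] := actY _ _ onC acts u uC.
  by rewrite Yu //; case: (x =P star u) => [-> | _]; rewrite ?mulr1 ?mulr0 ?eqxx.
split; last first.
  move=> star eps onC acts u uC.
  have [sC e0 Yu] := actY _ _ onC acts u uC.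
  have uniq := Yuniq _ _ onC acts.
  have Ysu : Y (star u) u = eps u by rewrite Yu // eqxx mulr1.
  have sigmaC := Csigma u uC; have VC : u^-1%g \in C by rewrite CV.
  have [ss es] : u = star (star u) /\ eps u = eps (star u).
    have := uniq (star u) u sC uC; rewrite -Ysym // Ysu; exact.
  have [sg eg] : sigma (star u) = star (sigma u) /\ eps u = eps (sigma u).
    have := uniq (sigma u) (sigma (star u)) sigmaC (Csigma _ sC).
    rewrite Ysigma // Ysu; exact.
  have [sVC eV0 YV] := actY _ _ onC acts _ VC.
  have YsV : Y (star u^-1%g) u^-1%g = eps u^-1%g by rewrite YV // eqxx mulr1.
  have [sf ef] : (star u^-1%g)^-1%g = star (sigma u) /\ eps u^-1%g = eps (sigma u).
    have := Yflat _ _ VC sVC; rewrite invgK YsV => Yf.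
    have := uniq (sigma u) (star u^-1%g)^-1%g sigmaC; rewrite CV Yf.
    by move=> /(_ sVC eV0).
  split; [by [] | split | by rewrite -sf sg].
  - by rewrite ef eg.
  - exact: eg.
  - by rewrite -eg es.
(* A column of [Y] indexed by [C] is nonzero, so the default is only used off [C]. *)
pose st u := if u \in C then odflt u [pick x in C | Y x u != 0] else u.
have stC u : u \in C -> st u \in C /\ Y (st u) u != 0.
  move=> uC; rewrite /st uC; case: pickP => [x /andP [] // | no].
  have [x xC [Yx _]] := Ymono u uC; have := no x; rewrite /= xC.
  by case: Yx => ->.
have stE u x : u \in C -> x \in C -> Y x u != 0 -> x = st u.
  move=> uC xC Yx; have [y yC [_ Y0]] := Ymono u uC.
  have all_y z : z \in C -> Y z u != 0 -> z = y.
    by move=> zC; apply: contra_neq_eq => zy; exact: Y0.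
  by have [sC Ys] := stC u uC; rewrite (all_y _ sC Ys) (all_y _ xC Yx).
have stK : involutive st.
  move=> u; have [uC | uC] := boolP (u \in C); last first.
    by rewrite /st (negPf uC) (negPf uC).
  by have [sC Ys] := stC u uC; symmetry; apply: stE; rewrite // -Ysym.
pose star : {perm gT} := perm (inv_inj stK).
have onC : perm_on C star.
  by apply/subsetP => u; rewrite inE permE; apply: contraR => uC; rewrite /st (negPf uC).
have acts : longest_acts H C a a' star (fun u => Y (st u) u).
  move=> u uC; have [sC Ys] := stC u uC; rewrite permE; split.
    have [x xC [Yx _]] := Ymono u uC; have -> // : st u = x.
    by symmetry; apply: stE => //; case: Yx => ->.
  apply/actP => // x xC; have [-> | ne] := eqVneq x (st u); first by rewrite mulr1.
  by rewrite mulr0; apply/eqP; apply: contraR ne => Yx; apply/eqP; exact: stE.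
exists star; split; first by split=> //; exists (fun u => Y (st u) u).
move=> star' [onC' [eps' acts']]; apply/permP => u.
have [uC | uC] := boolP (u \in C); last by rewrite !(out_perm _ uC).
have [sC Ys] := stC u uC; rewrite permE.
by have [] := Yuniq _ _ onC' acts' u (st u) uC sC Ys.
Qed.
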